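(* $\mathrm{FO}(<,\lhd,C,Q)$ has the same expressive power as $\mathrm{FO}(\mathrm{Bit})$ on the class of all finite structures.
   Context: Built-in predicates: a $k$-ary numerical predicate is a relation $P\subseteq\mathbb{N}^k$; on a finite structure with universe $[n]=\{0,1,\dots,n\}$ (for some $n\in\mathbb{N}$) it is interpreted as $P^n=P\cap[n]^k$. For a list $\ell$ of such predicates, $\mathrm{FO}(\ell)$ is first-order logic over finite structures with universe $[n]$ (for arbitrary $n$ and an arbitrary finite relational signature) in which, in addition, symbols for the predicates in $\ell$ may be used, interpreted as $P^n$. Two such logics have the same expressive power if every formula of either logic is equivalent, on all finite structures, to a formula of the other. Here $<$ is the usual order on $\mathbb{N}$ and $\mathrm{Bit}=\{(a,i)\in\mathbb{N}^2 : 2\nmid\lfloor a/2^i\rfloor\}$. Let $q_i=\frac{i(i+1)}{2}$ for $i\in\mathbb{N}$. For $x\in\mathbb{N}$ let $c(x)=\max\{i\in\mathbb{N}: q_i\le x\}$ (the column of $x$), $q(x)=q_{c(x)}$, and $r(x)=x-q(x)$ (the row of $x$); so $0\le r(x)\le c(x)$. Define the linear order $\lhd$ on $\mathbb{N}$ by $x\lhd y$ iff $r(x)<r(y)$, or $r(x)=r(y)$ and $c(x)<c(y)$. Define unary predicates $C=\{x\in\mathbb{N}: 2\nmid\lfloor (c(x)+1)/2^{r(x)}\rfloor\}$ (bit $r(x)$ of $c(x)+1$ is 1) and $Q=\{x\in\mathbb{N}: 2\nmid\lfloor q_{c(x)+1}/2^{r(x)}\rfloor\}$ (bit $r(x)$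 of $q_{c(x)+1}$ is 1). *)

(* Defs.v *)
From mathcomp Require Import all_boot.
Set Implicit Arguments. Unset Strict Implicit. Unset Printing Implicit Defensive.

(* A k-ary numerical predicate P ⊆ ℕ^k, given by its arity and a test on
   tuples (lists) of naturals; only lists of length [bp_arity] matter. *)
Record builtin := Builtin { bp_arity : nat; bp_rel : seq nat -> bool }.

Definition dummy_builtin : builtin := Builtin 0 (fun _ => false).

(* variables are natural numbers; relation symbols of the signature and
   built-in predicates of the list are referred to by their index *)
Inductive formula : Type :=
| FEq  of nat & nat
| FRel of nat & seq nat
| FPred of nat & seq nat
| FNot of formula
| FAnd of formula & formula
| FEx  of nat & formula.

(* A signature is the list of arities of its relation symbols. *)
Definition signature := seq nat.

Fixpoint wf (l : seq builtin) (sg : signature) (f : formula) : bool :=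
  match f with
  | FEq _ _ => true
  | FRel i xs => (i < size sg) && (size xs == nth 0 sg i)
  | FPred j xs => (j < size l) && (size xs == bp_arity (nth dummy_builtin l j))
  | FNot g => wf l sg g
  | FAnd g h => wf l sg g && wf l sg h
  | FEx _ g => wf l sg g
  end.

(** * Finite structures with universe [n] = {0,...,n} *)
(* st_rel i is the interpretation of the i-th relation symbol; only its
   values on tuples of elements of [n] are ever consulted. *)
Record structure := Structure { st_n : nat; st_rel : nat -> seq nat -> bool }.

Definition upd (a : nat -> nat) (x v : nat) : nat -> nat :=
  fun y => if y == x then v else a y.

Fixpoint sat (l : seq builtin) (A : structure) (a : nat -> nat) (f : formula)
  : Prop :=
  match f with
  | FEq x y => a x = a y
  | FRel i xs => st_rel A i (map a xs)
  | FPred j xs =>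
      bp_rel (nth dummy_builtin l j) (map a xs) && all (fun v => v <= st_n A) (map a xs)
  | FNot g => ~ sat l A a g
  | FAnd g h => sat l A a g /\ sat l A a h
  | FEx x g => exists v, v <= st_n A /\ sat l A (upd a x v) g
  end.

Definition equivalent (l1 l2 : seq builtin) (phi psi : formula) : Prop :=
  forall (A : structure) (a : nat -> nat),
    (forall x, a x <= st_n A) -> (sat l1 A a phi <-> sat l2 A a psi).

Definition translates (l1 l2 : seq builtin) : Prop :=
  forall (sg : signature) (phi : formula), wf l1 sg phi ->
    exists psi, wf l2 sg psi /\ equivalent l1 l2 phi psi.

Definition same_expressive_power (l1 l2 : seq builtin) : Prop :=
  translates l1 l2 /\ translates l2 l1.

Definition tri (i : nat) : nat := (i * i.+1) %/ 2.
Definition col (x : nat) : nat := \max_(i < x.+1 | tri i <= x) i.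
Definition qof (x : nat) : nat := tri (col x).
Definition row (x : nat) : nat := x - qof x.

Definition lhd (x y : nat) : bool :=
  (row x < row y) || ((row x == row y) && (col x < col y)).

Definition Cset (x : nat) : bool := odd ((col x).+1 %/ 2 ^ row x).
Definition Qset (x : nat) : bool := odd (tri (col x).+1 %/ 2 ^ row x).
Definition bit (a i : nat) : bool := odd (a %/ 2 ^ i).

Definition binary (R : nat -> nat -> bool) : builtin :=
  Builtin 2 (fun s => if s is [:: x; y] then R x y else false).
Definition unary (P : nat -> bool) : builtin :=
  Builtin 1 (fun s => if s is [:: x] then P x else false).

Definition Lt_b : builtin := binary (fun x y => x < y).
Definition Lhd_b : builtin := binary lhd.
Definition C_b : builtin := unary Cset.
Definition Q_b : builtin := unary Qset.
Definition Bit_b : builtin := binary bit.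

(* Main.v *)
(** One direction is arithmetic in FO(Bit).  An element codes the set of its
    bit positions, so FO(Bit) on [n] quantifies over sets of numbers below
    log n; the order is the lexicographic order of these sets.  Below log log n
    it is defined by guessing the chain of initial segments, and the order of
    bit positions lifts to the order of numbers, which is used three times to
    reach n.  Addition is carry lookahead.
    Multiplication is the schoolbook method in base 2^K with K about
    sqrt (log n): products of two digits, column sums and carries are sequences
    of O(K) numbers with O(K) bits, hence a whole computation is coded by
    boundedly many elements.  Products give the triangular numbers and thus
    columns and rows; over the finitely many sizes too small for the encodings,
    relations are defined by listing their elements.

    Conversely, < and the order by rows recover the columns and rows of the
    triangular array.  The predicates C and Q in columns r-1 and c-1 list the
    bits of r and of q_c, so carry lookahead gives the bits of x = q_c + r at
    positions represented by rows, and comparing bits identifies a row with the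
    element that is its index. *)

Require Import Defs.
From Stdlib Require Import Classical.
From mathcomp Require Import all_boot zify.
Set Implicit Arguments. Unset Strict Implicit. Unset Printing Implicit Defensive.

(** * Definability *)

Fixpoint var_bound (f : formula) : nat :=
  match f with
  | FEq x y => maxn x.+1 y.+1
  | FRel _ xs | FPred _ xs => \max_(x <- xs) x.+1
  | FNot g => var_bound g
  | FAnd g h => maxn (var_bound g) (var_bound h)
  | FEx x g => maxn x.+1 (var_bound g)
  end.

Lemma sat_agree l A f a b :
  (forall x, x < var_bound f -> a x = b x) -> sat l A a f <-> sat l A b f.
Proof.
have map_agree xs : (forall x, x < \max_(y <- xs) y.+1 -> a x = b x) ->
    map a xs = map b xs.
  by move=> ab; apply/eq_in_map => x x_xs; apply: ab; apply: leq_bigmax_seq.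
elim: f a b map_agree => [x y|i xs|i xs|g IH|g IHg h IHh|x g IH] a b map_agree ab /=.
- by rewrite !ab //= ?leq_max ?ltnSn ?orbT.
- by rewrite map_agree.
- by rewrite map_agree.
- by move: (IH a b map_agree ab); tauto.
- have := IHg a b map_agree; have := IHh a b map_agree.
  move=> /(_ _)-> => [|x xh]; last by apply: ab; rewrite leq_max xh orbT.
  by move=> /(_ _)-> // x xg; apply: ab; rewrite leq_max xg.
- have E v : sat l A (upd a x v) g <-> sat l A (upd b x v) g.
    have ab' y : y < var_bound g -> upd a x v y = upd b x v y.
      by rewrite /upd; case: eqP => // _ yg; apply: ab; rewrite leq_max yg orbT.
    apply: IH ab' => xs ab'; apply/eq_in_map => y y_xs; apply: ab'.
    exact: leq_bigmax_seq.
  by split=> -[v [vn sv]]; exists v; split=> //; apply/E.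
Qed.

Lemma rename l (f : formula) (s : nat -> nat) :
  exists g, (forall sg, wf l sg f -> wf l sg g) /\
    forall A a, sat l A a g <-> sat l A (fun x => a (s x)) f.
Proof.
elim: f s => [x y|i xs|i xs|g IH|g IHg h IHh|x g IH] s.
- by exists (FEq (s x) (s y)).
- by exists (FRel i (map s xs)); split=> [sg|A a] /=; rewrite ?size_map // -map_comp.
- by exists (FPred i (map s xs)); split=> [sg|A a] /=; rewrite ?size_map // -map_comp.
- have [g' [wg sg]] := IH s; exists (FNot g'); split=> //= A a.
  by have := sg A a; tauto.
- have [g' [wg sg]] := IHg s; have [h' [wh sh]] := IHh s.
  exists (FAnd g' h'); split=> [sg'|A a] /=; first by case/andP=> /wg-> /wh->.
  by have := sg A a; have := sh A a; tauto.
(* [z] exceeds the image under [s] of every variable of [g], so rebinding it captures nothing. *)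
- pose z := (\max_(y <- iota 0 (var_bound g)) s y).+1.
  have [g' [wg sg]] := IH (upd s x z).
  exists (FEx z g'); split=> //= A a.
  have E v : sat l A (upd a z v) g' <-> sat l A (upd (fun y => a (s y)) x v) g.
    apply: (iff_trans (sg _ _)); apply: sat_agree => y yg.
    rewrite /upd; case: (eqVneq y x) => _; first by rewrite eqxx.
    have: s y < z by rewrite ltnS leq_bigmax_seq ?mem_iota.
    by rewrite ltn_neqAle => /andP[/negbTE->].
  by split=> -[v [vn sv]]; exists v; split=> //; apply/E.
Qed.

(** One formula serves all signatures and all sizes from [N] on. Small sizes may be ignored at
    first; [D_all_sizes] lowers the threshold to 0. *)
Definition definable (l : seq builtin) (N : nat) (P : nat -> (nat -> nat) -> Prop) :=
  exists f, (forall sg, wf l sg f) /\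
    forall A a, N <= st_n A -> (forall x, a x <= st_n A) ->
      (sat l A a f <-> P (st_n A) a).

Section Definable.
Variables (l : seq builtin) (N : nat).
Local Notation D := (definable l N).

Lemma D_ext (P Q : nat -> (nat -> nat) -> Prop) :
    (forall n a, N <= n -> (forall x, a x <= n) -> (P n a <-> Q n a)) ->
  D P -> D Q.
Proof.
move=> PQ [f [wff sf]]; exists f; split=> // A a nA an.
by apply: iff_trans (sf A a nA an) (PQ _ _ nA an).
Qed.

Lemma D_rename (s : nat -> nat) (P : nat -> (nat -> nat) -> Prop) :
  D P -> D (fun n a => P n (fun x => a (s x))).
Proof.
case=> f [wff sf]; have [g [wg sg]] := rename l f s.
exists g; split=> [sg'|A a nA an]; first exact: wg.
by apply: iff_trans (sg A a) (sf _ _ nA _).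
Qed.

Lemma D_not P : D P -> D (fun n a => ~ P n a).
Proof.
case=> f [wff sf]; exists (FNot f); split=> //= A a nA an.
by have := sf A a nA an; tauto.
Qed.

Lemma D_and P Q : D P -> D Q -> D (fun n a => P n a /\ Q n a).
Proof.
case=> f [wff sf] [g [wfg sg]]; exists (FAnd f g); split=> [s|A a nA an] /=.
  by rewrite wff wfg.
by have := sf A a nA an; have := sg A a nA an; tauto.
Qed.

(** Variables act as de Bruijn indices: the quantified element is read at 0 and the others move up
    by one. In the formula itself a variable beyond those of [f] stands for index 0. *)
Lemma D_ex (P : nat -> (nat -> nat) -> nat -> Prop) :
    D (fun n a => P n (fun x => a x.+1) (a 0)) ->
  D (fun n a => exists v, v <= n /\ P n a v).
Proof.
case=> f [wff sf]; pose z := var_bound f.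
have [g [wg sg]] := rename l f (fun x => if x is y.+1 then y else z).
exists (FEx z g); split=> [s|A a nA an] /=; first exact: wg.
suff E v : v <= st_n A -> (sat l A (upd a z v) g <-> P (st_n A) a v).
  by split=> -[v [vn sv]]; exists v; split=> //; apply/E.
move=> vn; apply: (iff_trans (sg _ _)).
have := sf A (fun x => if x is y.+1 then a y else v) nA.
move=> H; apply: iff_trans (H _); last by case.
apply: sat_agree => -[|y] yf; rewrite /upd ?eqxx // ifN //.
by rewrite neq_ltn (ltn_trans _ yf).
Qed.

Lemma D_or P Q : D P -> D Q -> D (fun n a => P n a \/ Q n a).
Proof.
move=> DP DQ; apply: (D_ext _ (D_not (D_and (D_not DP) (D_not DQ)))) => n a _ _.
by have := classic (P n a); tauto.
Qed.

Lemma D_imp P Q : D P -> D Q -> D (fun n a => P n a -> Q n a).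
Proof.
move=> DP DQ; apply: (D_ext _ (D_or (D_not DP) DQ)) => n a _ _.
by have := classic (P n a); tauto.
Qed.

Lemma D_iff P Q : D P -> D Q -> D (fun n a => P n a <-> Q n a).
Proof. by move=> DP DQ; apply: D_and; apply: D_imp. Qed.

Lemma D_all (P : nat -> (nat -> nat) -> nat -> Prop) :
    D (fun n a => P n (fun x => a x.+1) (a 0)) ->
  D (fun n a => forall v, v <= n -> P n a v).
Proof.
move=> DP; apply: (D_ext _ (D_not (@D_ex (fun n a v => ~ P n a v) (D_not DP)))) => n a _ _ /=.
split=> [nP v vn|H [v [vn]]]; last by apply; apply: H.
by case: (classic (P n a v)) => // nPv; case: nP; exists v.
Qed.

Lemma D_eq i j : D (fun n a => a i = a j).
Proof. by exists (FEq i j); split. Qed.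

Lemma D_true : D (fun n a => True).
Proof. by apply: (D_ext _ (D_eq 0 0)) => n a _ _; split. Qed.

Lemma D_const (b : bool) : D (fun n a => b).
Proof.
case: b; first by apply: (D_ext _ D_true) => n a _ _; split.
by apply: (D_ext _ (D_not D_true)) => n a _ _; split=> // H; case: H.
Qed.

Lemma D_inst1 (R : nat -> nat -> Prop) i :
  D (fun n a => R n (a 0)) -> D (fun n a => R n (a i)).
Proof. exact: (D_rename (fun=> i)). Qed.

Lemma D_inst2 (R : nat -> nat -> nat -> Prop) i j :
  D (fun n a => R n (a 0) (a 1)) -> D (fun n a => R n (a i) (a j)).
Proof. exact: (D_rename (nth 0 [:: i; j])). Qed.

End Definable.

Lemma D_unary l N j P : j < size l -> nth dummy_builtin l j = unary P ->
  definable l N (fun n a => P (a 0)).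
Proof.
move=> jl lj; exists (FPred j [:: 0]); split=> [sg|A a _ an] /=; rewrite ?jl lj //=.
by rewrite an !andbT.
Qed.

Lemma D_binary l N j R : j < size l -> nth dummy_builtin l j = binary R ->
  definable l N (fun n a => R (a 0) (a 1)).
Proof.
move=> jl lj; exists (FPred j [:: 0; 1]); split=> [sg|A a _ an] /=; rewrite ?jl lj //=.
by rewrite !an !andbT.
Qed.

(** Only the atoms of built-in predicates change: there the variables of a defining formula are
    renamed to the arguments. The threshold is 0 because equivalence concerns all sizes. *)
Lemma translates_of_definable l1 l2 :
    (forall j, j < size l1 -> let b := nth dummy_builtin l1 j in
      definable l2 0 (fun n a => bp_rel b (map a (iota 0 (bp_arity b))))) ->
  translates l1 l2.
Proof.
move=> Dl sg; elim=> [x y|i xs|j xs|f IH|f IHf g IHg|x f IH] /=.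
- by move=> _; exists (FEq x y).
- by exists (FRel i xs).
- case/andP=> /Dl[f [wff sf]] /eqP sxs.
  have [g [wg sg']] := rename l2 f (nth 0 xs).
  exists g; split=> [|A a an]; first exact: wg.
  apply: iff_sym; apply: (iff_trans (sg' A a)).
  apply: (iff_trans (sf A _ _ _)) => //=.
  rewrite (_ : all _ _) ?andbT; last by apply/allP => _ /mapP[x _ ->].
  by rewrite -sxs (map_comp a (nth 0 xs)) -[X in map _ X]/(mkseq _ _) mkseq_nth.
- by move=> /IH[g [wg E]]; exists (FNot g); split=> // A a an /=; have := E A a an; tauto.
- case/andP=> /IHf[f' [wf' Ef]] /IHg[g' [wg' Eg]].
  exists (FAnd f' g'); rewrite /= wf' wg'; split=> // A a an /=.
  by have := Ef A a an; have := Eg A a an; tauto.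
- case/IH=> g [wg E]; exists (FEx x g); split=> // A a an /=.
  suff E' v : v <= st_n A -> (sat l1 A (upd a x v) f <-> sat l2 A (upd a x v) g).
    by split=> -[v [vn sv]]; exists v; split=> //; apply/E'.
  by move=> vn; apply: E => y; rewrite /upd; case: eqP.
Qed.

(** * Bits and carries *)

Lemma bit_0 a : bit a 0 = odd a.
Proof. by rewrite /bit divn1. Qed.

Lemma bit_S a i : bit a i.+1 = bit a./2 i.
Proof. by rewrite /bit expnS divnMA divn2. Qed.

Lemma bit_0n i : bit 0 i = false.
Proof. by rewrite /bit div0n. Qed.

Lemma bit_geq a i : a < 2 ^ i -> bit a i = false.
Proof. by move=> ai; rewrite /bit divn_small. Qed.

Lemma bit_lt_exp a i m : a < 2 ^ m -> bit a i -> i < m.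
Proof.
move=> am; apply: contraTT; rewrite -leqNgt => mi; rewrite bit_geq //.
by apply: leq_trans am _; rewrite leq_pexp2l.
Qed.

Lemma bit_lt a i : bit a i -> i < a.
Proof. by apply: bit_lt_exp; apply: ltn_expl. Qed.

Lemma bit_ext a b : bit a =1 bit b -> a = b.
Proof.
elim/ltn_ind: a b => a IH b ab.
have := ab 0; rewrite !bit_0 => odd_ab.
case: (posnP a) => [a0|a0].
  apply: NNPP => /eqP; rewrite a0 eq_sym -lt0n => b0.
  have [i ib]: exists i, bit b i.
    exists (trunc_log 2 b); rewrite /bit.
    have /andP[lo hi] := trunc_log_bounds (isT : 1 < 2) b0.
    suff -> : b %/ 2 ^ trunc_log 2 b = 1 by [].
    apply/eqP; rewrite eqn_leq -ltnS ltn_divLR ?expn_gt0 // -expnS hi /=.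
    by rewrite divn_gt0 ?expn_gt0.
  by have := ab i; rewrite a0 bit_0n ib.
rewrite -[a]odd_double_half -[b]odd_double_half odd_ab (IH a./2 _ b./2) //.
  lia.
by move=> i; have := ab i.+1; rewrite !bit_S.
Qed.

Lemma exists_bits (p : pred nat) m :
  exists2 w, w < 2 ^ m & forall i, bit w i = (i < m) && p i.
Proof.
elim: m p => [|m IH] p; first by exists 0 => // i; rewrite bit_0n.
have [w wm wp] := IH (fun i => p i.+1).
exists (p 0 + w.*2); first by rewrite expnS; case: (p 0); lia.
case=> [|i]; first by rewrite bit_0 oddD odd_double addbF oddb.
by rewrite bit_S half_bit_double wp.
Qed.

Lemma bit_modn a l i : bit (a %% 2 ^ l) i = (i < l) && bit a i.
Proof.
elim: l a i => [|l IH] a i; first by rewrite modn1 bit_0n.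
have -> : a %% 2 ^ l.+1 = odd a + (a./2 %% 2 ^ l).*2.
  rewrite -{1}[a]odd_double_half -!muln2 expnSr.
  rewrite -modnDmr -muln_modl modn_small //.
  by have := ltn_pmod a./2 (expn_gt0 2 l); case: (odd a); lia.
case: i => [|i]; first by rewrite !bit_0 oddD odd_double addbF oddb.
by rewrite !bit_S half_bit_double IH.
Qed.

Lemma bit_divn a k i : bit (a %/ 2 ^ k) i = bit a (k + i).
Proof. by rewrite /bit -divnMA -expnD. Qed.

Lemma ltn_bits a b : a < b <->
  exists2 i, bit b i && ~~ bit a i & forall j, i < j -> bit a j = bit b j.
Proof.
split.
  elim/ltn_ind: b a => b IH a ab.
  case: (ltngtP a./2 b./2) => [h|h|h].
  - have [i] := IH b./2 ltac:(lia) _ h.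
    by rewrite -!bit_S => ib H; exists i.+1 => // -[|j] //; rewrite ltnS !bit_S; apply: H.
  - lia.
  - exists 0 => [|[|j] //]; last by rewrite !bit_S h.
    rewrite !bit_0; lia.
case=> i; elim: i a b => [|i IH] a b /andP[bi ai] H.
  suff : a./2 = b./2 by move: bi ai; rewrite !bit_0; lia.
  by apply: bit_ext => j; rewrite -!bit_S H.
suff : a./2 < b./2 by lia.
apply: IH => [|j ij]; rewrite -!bit_S ?bi //; exact: H.
Qed.

Fixpoint carry (c : bool) (x y i : nat) : bool :=
  if i is j.+1 then
    bit x j && bit y j || (bit x j || bit y j) && carry c x y j
  else c.

(** Carry lookahead: a carry into [i] is generated at some [j] and propagated by every position in
    between. Unlike the recursion, this is a first-order condition on bits. *)
Lemma carryP x y i : carry false x y i <->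
  exists2 j, j < i & (bit x j && bit y j) /\
    forall k, j < k -> k < i -> bit x k || bit y k.
Proof.
elim: i => [|i IH] /=; first by split=> // -[].
split.
  case/orP=> [xy|/andP[xy /IH[j ji [xyj H]]]].
    by exists i => //; split=> // k; lia.
  exists j; first lia.
  split=> // k jk; rewrite ltnS leq_eqVlt => /orP[/eqP-> //|]; exact: H.
case=> j; rewrite ltnS leq_eqVlt => /orP[/eqP-> [-> //]|ji [xyj H]].
rewrite (H i) // andTb; apply/orP; right; apply/IH; exists j => //; split=> // k jk ki.
by apply: H => //; lia.
Qed.

Lemma bit_addn x y i : bit (x + y) i = bit x i (+) bit y i (+) carry false x y i.
Proof.
(* Halving [x] and [y] turns the carry out of bit 0 into an incoming carry, so the induction needs
   an arbitrary [c]. *)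
suff H (c : bool) : bit (c + x + y) i = bit x i (+) bit y i (+) carry c x y i.
  by rewrite -[x]add0n (H false).
elim: i x y c => [|i IH] x y c.
  by rewrite !bit_0 !oddD oddb /=; case: c; case: (odd x); case: (odd y).
have E : (c + x + y)./2 = (odd x && odd y || (odd x || odd y) && c) + x./2 + y./2.
  by case: c; move: (odd_double_half x) (odd_double_half y);
    case: (odd x); case: (odd y) => /=; lia.
rewrite !bit_S E IH; congr (_ (+) _).
by elim: i {IH} => [|i /= <-]; rewrite /= ?bit_0 // !bit_S.
Qed.

(** * The order in FO(Bit) *)

Lemma D_andb l N (p q : nat -> (nat -> nat) -> bool) :
  definable l N (fun n a => p n a /\ q n a) -> definable l N (fun n a => p n a && q n a).
Proof. by apply: D_ext => n a _ _; split=> /andP. Qed.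

Lemma D_orb l N (p q : nat -> (nat -> nat) -> bool) :
  definable l N (fun n a => p n a \/ q n a) -> definable l N (fun n a => p n a || q n a).
Proof. by apply: D_ext => n a _ _; split=> /orP. Qed.

Lemma D_negb l N (p : nat -> (nat -> nat) -> bool) :
  definable l N (fun n a => ~ p n a) -> definable l N (fun n a => ~~ p n a).
Proof. by apply: D_ext => n a _ _; split=> /negP. Qed.

Lemma D_eqb l N (p q : nat -> (nat -> nat) -> bool) :
  definable l N (fun n a => p n a <-> q n a) -> definable l N (fun n a => p n a = q n a).
Proof. by apply: D_ext => n a _ _; split=> [/Bool.eq_iff_eq_true|->]. Qed.

Lemma D_addb l N (p q : nat -> (nat -> nat) -> bool) :
  definable l N (fun n a => ~ (p n a <-> q n a)) -> definable l N (fun n a => p n a (+) q n a).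
Proof.
apply: D_ext => n a _ _; case: (p n a); case: (q n a) => /=; by intuition.
Qed.

Lemma D_eqn l N i j : definable l N (fun n a => a i == a j).
Proof. by apply: (D_ext _ (D_eq l N i j)) => n a _ _; split=> /eqP. Qed.

Create HintDb definability.
#[local] Hint Resolve D_eq D_eqn D_true D_const : definability.

(** Peels off connectives and bounded quantifiers by the closure lemmas and leaves atoms to the hint
    database. A relation is thus shown definable by an equivalent formula whose witnesses are
    bounded by [n]. *)
Ltac definable_step :=
  cbv beta;
  lazymatch goal with
  | |- definable _ _ (fun n a => @?P n a <-> @?Q n a) => apply: (@D_iff _ _ P Q)
  | |- definable _ _ (fun n a => ~ @?P n a) => apply: (@D_not _ _ P)
  | |- definable _ _ (fun n a => @?P n a /\ @?Q n a) => apply: (@D_and _ _ P Q)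
  | |- definable _ _ (fun n a => @?P n a \/ @?Q n a) => apply: (@D_or _ _ P Q)
  | |- definable _ _ (fun n a => exists v, is_true (v <= n) /\ @?P n a v) =>
      apply: (@D_ex _ _ P)
  | |- definable _ _ (fun n a => forall v, is_true (v <= n) -> @?P n a v) =>
      apply: (@D_all _ _ P)
  | |- definable _ _ (fun n a => @?P n a -> @?Q n a) => apply: (@D_imp _ _ P Q)
  | |- definable _ _ (fun n a => is_true (@?p n a && @?q n a)) => apply: (@D_andb _ _ p q)
  | |- definable _ _ (fun n a => is_true (@?p n a || @?q n a)) => apply: (@D_orb _ _ p q)
  | |- definable _ _ (fun n a => is_true (~~ @?p n a)) => apply: (@D_negb _ _ p)
  | |- definable _ _ (fun n a => is_true (@?p n a (+) @?q n a)) => apply: (@D_addb _ _ p q)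
  | |- definable _ _ (fun n a => @eq bool (@?p n a) (@?q n a)) => apply: (@D_eqb _ _ p q)
  | |- _ => solve [eauto 2 with definability]
  end.
Ltac definability := repeat definable_step.

Local Notation DB := (definable [:: Bit_b]).

Lemma DB_bit N i j : DB N (fun n a => bit (a i) (a j)).
Proof. by apply: (D_inst2 (R := fun _ x y => bit x y)); apply: (@D_binary _ _ 0). Qed.
#[local] Hint Resolve DB_bit : definability.

Definition lex_step (n : nat) (R : nat -> nat -> Prop) (x y : nat) : Prop :=
  exists i, i <= n /\ (bit y i /\ ~ bit x i /\
    forall j, j <= n -> ~ (bit x j <-> bit y j) -> j <> i -> R j i).

(** [R] has to be correct only on positions that carry a bit of [x] or [y], because no other
    position can distinguish them. *)
Lemma lex_stepP n R x y :
    (forall i j, bit x i || bit y i -> bit x j || bit y j -> (R i j <-> i < j)) ->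
  x <= n -> y <= n -> (lex_step n R x y <-> x < y).
Proof.
move=> HR xn yn; apply: (iff_trans _ (iff_sym (ltn_bits x y))); split.
  case=> i [_ [yi [/negP xi H]]]; exists i; first by rewrite yi.
  move=> j ij; apply: NNPP => xyj.
  have bj : bit x j || bit y j by move: xyj; case: (bit x j); case: (bit y j).
  have jn : j <= n by case/orP: bj => /bit_lt; lia.
  have: R j i by apply: H => //; [move/Bool.eq_iff_eq_true: xyj | lia].
  by rewrite HR ?yi ?orbT //; lia.
case=> i /andP[yi xi] H; exists i; split; first by move/bit_lt: yi; lia.
split=> //; split; first exact/negP.
move=> j jn xyj ji.
have bj : bit x j || bit y j.
  by apply: contraT => /norP[/negbTE xj /negbTE yj]; case: xyj; rewrite xj yj.
rewrite HR ?yi ?orbT //; case: (ltngtP i j) => // ij; last by rewrite ij in ji.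
by case: xyj; rewrite (H _ ij).
Qed.

(* An element w codes a finite family of sets of indices; when that family is
   a chain of initial segments, the order on its union can be read off w. *)
Definition chain_mem (n w x : nat) : Prop :=
  exists s, s <= n /\ (bit w s /\ bit s x).

Definition chain_lt (n w x y : nat) : Prop :=
  exists s, s <= n /\ (bit w s /\ bit s x /\ ~ bit s y).

Definition chain_order (n w : nat) : Prop :=
  (forall x, x <= n -> chain_mem n w x -> forall y, y <= n -> bit x y -> chain_mem n w y)
  /\ forall x, x <= n -> forall y, y <= n -> chain_mem n w x -> chain_mem n w y ->
     (chain_lt n w x y <-> lex_step n (chain_lt n w) x y).

(** Every [w] passing the test yields the true order, whatever it codes: the bits of [x] and [y] are
    smaller members of the union, where [chain_lt] is correct by induction on the maximum, and the
    fixed-point clause of [chain_order] carries this over to [x] and [y]. *)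
Lemma chain_orderP n w x y : chain_order n w -> x <= n -> y <= n ->
  chain_mem n w x -> chain_mem n w y -> (chain_lt n w x y <-> x < y).
Proof.
case=> trans lex.
have [m] := ubnP (maxn x y); elim: m x y => // m IH x y.
rewrite gtn_max => /andP[xm ym] xn yn xw yw.
apply: (iff_trans (lex _ xn _ yn xw yw)); apply: lex_stepP => // i j.
have small k : bit x k || bit y k -> [/\ k < m, k <= n & chain_mem n w k].
  case/orP=> bk; move: (bit_lt bk) => kl; (split; try lia).
    by apply: trans bk => //; lia.
  by apply: trans bk => //; lia.
by move=> /small[im ik iw] /small[jm jk jw]; apply: IH => //; lia.
Qed.

Lemma bit_pred_exp2 k x : bit (2 ^ k).-1 x = (x < k).
Proof.
elim: k x => [|k IH] x; first by rewrite bit_0n.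
have -> : (2 ^ k.+1).-1 = true + (2 ^ k).-1.*2 by rewrite expnS; have := expn_gt0 2 k; lia.
case: x => [|x]; first by rewrite bit_0 oddD odd_double addbF.
by rewrite bit_S half_bit_double IH.
Qed.

Definition small_lt (n x y : nat) : Prop :=
  exists w, w <= n /\ (chain_order n w /\ chain_mem n w x /\ chain_mem n w y /\ chain_lt n w x y).

Lemma small_ltP n M x y : 2 ^ (2 ^ M) <= n.+1 -> x < M -> y < M ->
  (small_lt n x y <-> x < y).
Proof.
move=> Mn xM yM.
have ltM k : k < 2 ^ M -> k <= n by move: (ltn_expl (2 ^ M) (isT : 1 < 2)); lia.
have ltM' k : k < M -> k <= n by move=> kM; apply: ltM; move: (ltn_expl M (isT : 1 < 2)); lia.
split=> [[w [_ [ow [xw [yw]]]]]|xy].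
  by move=> H; apply/(chain_orderP ow) => //; apply: ltM'.
(* The witness codes the initial segments of length [k <= M], since [(2 ^ k).-1] has exactly the
   bits below [k]. All members are below [2 ^ M], so [w < 2 ^ (2 ^ M) <= n.+1]. *)
have [w wM bw] := exists_bits (fun s => has (fun k => s == (2 ^ k).-1) (iota 0 M.+1)) (2 ^ M).
have bwP s : bit w s <-> exists2 k, k <= M & s = (2 ^ k).-1.
  rewrite bw; split=> [/andP[_ /hasP[k]]|[k kM ->]].
    by rewrite mem_iota ltnS => kM /eqP ->; exists k.
  apply/andP; split; last by apply/hasP; exists k; rewrite ?mem_iota.
  by rewrite prednK ?expn_gt0 // leq_pexp2l.
have bws k : k <= M -> (2 ^ k).-1 <= n.
  by move=> kM; apply: ltM; rewrite prednK ?expn_gt0 // leq_pexp2l.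
have memP z : chain_mem n w z <-> z < M.
  split=> [[s [_ [/bwP[k kM ->]]]]|zM]; first by rewrite bit_pred_exp2; lia.
  exists (2 ^ M).-1; rewrite bws // bit_pred_exp2; split=> //; split=> //.
  by apply/bwP; exists M.
have cltP u v : u < M -> v < M -> (chain_lt n w u v <-> u < v).
  move=> uM vM; split.
    by case=> s [_ [/bwP[k kM ->]]]; rewrite !bit_pred_exp2; lia.
  move=> uv; exists (2 ^ v).-1; rewrite bws ?(ltnW vM) //; split=> //.
  split; first by apply/bwP; exists v => //; lia.
  by rewrite !bit_pred_exp2; lia.
exists w; split; first lia.
split; last by rewrite !memP cltP.
split=> [u un /memP uM v vn /bit_lt vu|u un v vn /memP uM /memP vM]; first by apply/memP; lia.
rewrite cltP //; apply: iff_sym; apply: lex_stepP => // i j bi bj; apply: cltP.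
  by case/orP: bi => /bit_lt; lia.
by case/orP: bj => /bit_lt; lia.
Qed.

Lemma lex_step_lt n R m : (forall x y, x < m -> y < m -> (R x y <-> x < y)) ->
  forall x y, x <= n -> y <= n -> x < 2 ^ m -> y < 2 ^ m -> (lex_step n R x y <-> x < y).
Proof.
move=> HR x y xn yn xm ym; apply: lex_stepP => // i j.
by move=> /orP[]b1 /orP[]b2; apply: HR; (apply: bit_lt_exp b1 || apply: bit_lt_exp b2).
Qed.

Definition lex_lt (n k : nat) : nat -> nat -> Prop := iter k (lex_step n) (small_lt n).

(** When [2 ^ (2 ^ M) <= n.+1 < 2 ^ (2 ^ M.+1)], the guessed order is correct below [M], and the
    three lifts reach [M.+1] (as [M.+1 <= 2 ^ M]), [2 ^ M.+1] and [2 ^ (2 ^ M.+1)], which is beyond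
    [n]. *)
Lemma lex_ltP n x y : x <= n -> y <= n -> (lex_lt n 3 x y <-> x < y).
Proof.
move=> xn yn; case: (posnP n) => [n0|n0].
  have [-> ->] : x = 0 /\ y = 0 by lia.
  by split=> // -[i [_ []]]; rewrite bit_0n.
have : exists M, 2 ^ (2 ^ M) <= n.+1 < 2 ^ (2 ^ M.+1).
  exists (trunc_log 2 (trunc_log 2 n.+1)).
  have /andP[lo hi] := trunc_log_bounds (isT : 1 < 2) (isT : 0 < n.+1).
  have L0 : 0 < trunc_log 2 n.+1.
    by rewrite -ltnS -(ltn_exp2l _ _ (isT : 1 < 2)); apply: leq_ltn_trans hi; lia.
  have /andP[lo' hi'] := trunc_log_bounds (isT : 1 < 2) L0.
  rewrite (leq_trans _ lo) ?leq_pexp2l //=.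
  by apply: leq_trans hi _; rewrite leq_pexp2l.
case=> M /andP[lo hi].
have M2 := ltn_expl M (isT : 1 < 2); have M3 := ltn_expl (2 ^ M) (isT : 1 < 2).
have ex k : k < 2 ^ M.+1 -> k <= n.
  rewrite expnS; move=> kM.
  case: M {hi} lo M2 M3 kM => [|M].
    by rewrite !expn0 expn1; lia.
  move=> lo M2 M3 kM.
  have : 2 * 2 ^ M.+1 <= 2 ^ (2 ^ M.+1); last by lia.
  by rewrite -expnS leq_pexp2l.
have H1 := fun u v => @small_ltP n M u v lo.
have H2 : forall u v, u < M.+1 -> v < M.+1 -> (lex_lt n 1 u v <-> u < v).
  by move=> u v uM vM; apply: (lex_step_lt H1); lia.
have H3 : forall u v, u < 2 ^ M.+1 -> v < 2 ^ M.+1 -> (lex_lt n 2 u v <-> u < v).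
  by move=> u v uM vM; apply: (lex_step_lt H2) => //; apply: ex.
by apply: (lex_step_lt H3) => //; lia.
Qed.

Lemma DB_lt N i j : DB N (fun n a => a i < a j).
Proof.
have D0 i' j' : DB N (fun n a => small_lt n (a i') (a j')).
  by rewrite /small_lt /chain_order /lex_step /chain_mem /chain_lt; definability.
have D1 i' j' : DB N (fun n a => lex_lt n 1 (a i') (a j')).
  by rewrite /lex_lt /= /lex_step; definability.
have D2 i' j' : DB N (fun n a => lex_lt n 2 (a i') (a j')).
  by rewrite /lex_lt /= -/(lex_lt _ 1) /lex_step; definability.
have D3 i' j' : DB N (fun n a => lex_lt n 3 (a i') (a j')).
  by rewrite /lex_lt /= -/(lex_lt _ 2) /lex_step; definability.
by apply: (D_ext _ (D3 i j)) => n a _ an; apply: lex_ltP.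
Qed.

(** * Addition and shifts in FO(Bit) *)

#[local] Hint Resolve DB_lt : definability.

Lemma D_leq l N i j : (forall i j, definable l N (fun n a => a i < a j)) ->
  definable l N (fun n a => a i <= a j).
Proof.
move=> Dlt; apply: (D_ext _ (D_not (Dlt j i))) => n a _ _.
by split; lia.
Qed.

Lemma D_succ l N i j : (forall i j, definable l N (fun n a => a i < a j)) ->
  definable l N (fun n a => (a i).+1 = a j).
Proof.
move=> Dlt.
suff H : definable l N (fun n a => a i < a j /\
    forall v, v <= n -> a i < v -> ~ v < a j).
  apply: (D_ext _ H) => n a _ an; split=> [[ij H']|<-]; last by split=> //; lia.
  apply/eqP; rewrite eqn_leq ij leqNgt; apply/negP => lt_ij.
  by apply: (H' (a i).+1) => //; have := an j; lia.
by have := Dlt; move=> *; definability.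
Qed.

Lemma D_eq_const l N c i : (forall i j, definable l N (fun n a => a i < a j)) ->
  definable l N (fun n a => a i = c).
Proof.
move=> Dlt; elim: c i => [|c IH] i.
  suff H : definable l N (fun n a => forall v, v <= n -> ~ v < a i).
    apply: (D_ext _ H) => n a _ _; split=> [H'|-> //].
    by apply/eqP; rewrite -leqn0 leqNgt; apply/negP; apply: H'.
  by have := Dlt; move=> *; definability.
suff H : definable l N (fun n a => exists v, v <= n /\ (v = c /\ v.+1 = a i)).
  apply: (D_ext _ H) => n a _ an; split=> [[v [_ [-> <-]]] //|ai].
  by exists c; split=> //; have := an i; lia.
by have Ds := fun i j => D_succ i j Dlt; definability.
Qed.

Lemma DB_leq N i j : DB N (fun n a => a i <= a j).
Proof. by apply: D_leq => *; apply: DB_lt. Qed.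

Lemma DB_succ N i j : DB N (fun n a => (a i).+1 = a j).
Proof. by apply: D_succ => *; apply: DB_lt. Qed.

Lemma DB_eq_const N i c : DB N (fun n a => a i = c).
Proof. by apply: D_eq_const => *; apply: DB_lt. Qed.

#[local] Hint Resolve DB_leq DB_succ DB_eq_const : definability.

Lemma leqn_bits n x y : x < 2 ^ n.+1 -> y < 2 ^ n.+1 ->
  (forall i, i <= n -> (bit x i <-> bit y i)) -> x = y.
Proof.
move=> xn yn H; apply: bit_ext => i.
case: (leqP i n) => [/H/Bool.eq_iff_eq_true //|ni].
by rewrite !bit_geq //; apply: leq_trans (leq_pexp2l (isT : 0 < 2) ni).
Qed.

Lemma addbP (p q : bool) : (p (+) q) <-> (p <-> ~ q).
Proof.
split=> [|[H1 H2]].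
  by case: p; case: q => //= _; split=> // H; case: (H isT).
by case: p q H1 H2 => [] [] //= H1 H2; [case: (H1 isT) | apply: H2].
Qed.

Lemma bit_addP x y i :
  bit (x + y) i <-> ((bit x i (+) bit y i) <-> ~ carry false x y i).
Proof.
by rewrite bit_addn addbP.
Qed.

(** The sum may lie outside the universe; carry lookahead still defines its bits at positions up to
    [n]. Both [DB_add] and [DB_Qset] rely on this. *)
Lemma DB_bit_add N i j k : DB N (fun n a => bit (a i + a j) (a k)).
Proof.
suff H : DB N (fun n a => (bit (a i) (a k) (+) bit (a j) (a k)) <->
    ~ exists p, p <= n /\ (p < a k /\ (bit (a i) p && bit (a j) p) /\
        forall q, q <= n -> p < q -> q < a k -> bit (a i) q || bit (a j) q)).
  apply: (D_ext _ H) => n a _ an; rewrite bit_addP carryP.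
  suff E : (exists2 p, p < a k & bit (a i) p && bit (a j) p /\
        forall q, p < q -> q < a k -> bit (a i) q || bit (a j) q) <->
      exists p, p <= n /\ (p < a k /\ (bit (a i) p && bit (a j) p) /\
        forall q, q <= n -> p < q -> q < a k -> bit (a i) q || bit (a j) q).
    by rewrite E.
  split=> [[p pk [b1 H1]]|[p [pn [pk [b1 H1]]]]].
    exists p; split; first by have := an k; lia.
    by split=> //; split=> // q _; apply: H1.
  exists p => //; split=> // q pq qk; apply: H1 => //.
  by have := an k; lia.
by definability.
Qed.
#[local] Hint Resolve DB_bit_add : definability.

Lemma DB_add N i j k : DB N (fun n a => a i + a j = a k).
Proof.
suff H : DB N (fun n a => forall p, p <= n -> (bit (a i + a j) p <-> bit (a k) p)).
  apply: (D_ext _ H) => n a _ an; split=> [H'|-> //].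
  have n2 := ltn_expl n (isT : 1 < 2).
  by apply: (leqn_bits (n := n)) H'; rewrite expnS;
    have := an i; have := an j; have := an k; lia.
by definability.
Qed.
#[local] Hint Resolve DB_add : definability.

Lemma DB_subn N i j k : DB N (fun n a => a i - a j = a k).
Proof.
suff H : DB N (fun n a => a k + a j = a i \/ a i < a j /\ a k = 0).
  by apply: (D_ext _ H) => n a _ an; split; lia.
by definability.
Qed.
#[local] Hint Resolve DB_subn : definability.

(** * Blocks of bits, shifts and binary logarithms *)

Definition slice (w p m : nat) : nat := (w %/ 2 ^ p) %% 2 ^ m.

Lemma bit_slice w p m i : bit (slice w p m) i = (i < m) && bit w (p + i).
Proof. by rewrite /slice bit_modn bit_divn. Qed.

Lemma slice_leq w p m : slice w p m <= w.
Proof. exact: leq_trans (leq_mod _ _) (leq_div _ _). Qed.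

Lemma leq_bits n x y : x <= n -> y <= n ->
  (forall i, i <= n -> (bit x i <-> bit y i)) -> x = y.
Proof.
move=> xn yn; have n2 := ltn_expl n (isT : 1 < 2).
by apply: leqn_bits; rewrite expnS; lia.
Qed.

Lemma DB_slice N v w p m : DB N (fun n a => a v = slice (a w) (a p) (a m)).
Proof.
suff H : DB N (fun n a => forall i, i <= n -> (bit (a v) i <->
    i < a m /\ exists q, q <= n /\ (a p + i = q /\ bit (a w) q))).
  apply: (D_ext _ H) => n a _ an.
  have E i : bit (slice (a w) (a p) (a m)) i <->
      i < a m /\ exists q, q <= n /\ (a p + i = q /\ bit (a w) q).
    rewrite bit_slice; split=> [/andP[im bi]|[-> [q [_ [-> ->]]]] //].
    by split=> //; exists (a p + i); split=> //; have := bit_lt bi; have := an w; lia.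
  split=> [H'|-> i _]; last exact: E.
  apply: (leq_bits (n := n)) => // [|i ni]; first exact: leq_trans (slice_leq _ _ _) _.
  by rewrite E H'.
by definability.
Qed.
#[local] Hint Resolve DB_slice : definability.

(** The power [2 ^ a j] may lie outside the universe, so the product is described by its bits: from
    [a j] on they are those of [a i], and the lower ones vanish. *)
Lemma DB_mul_exp2 N i j k : DB N (fun n a => a i * 2 ^ a j = a k).
Proof.
suff H : DB N (fun n a =>
    (forall p, p <= n -> (bit (a i) p <-> exists q, q <= n /\ (a j + p = q /\ bit (a k) q)))
    /\ forall p, p <= n -> p < a j -> ~ bit (a k) p).
  apply: (D_ext _ H) => n a _ an.
  have E p : bit (a k %/ 2 ^ a j) p <-> exists q, q <= n /\ (a j + p = q /\ bit (a k) q).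
    rewrite bit_divn; split=> [b|[q [_ [-> ->]]] //].
    by exists (a j + p); split=> //; have := bit_lt b; have := an k; lia.
  have E0 : (forall p, p <= n -> p < a j -> ~ bit (a k) p) <-> a k %% 2 ^ a j = 0.
    split=> [H'|H' p _ pj].
      apply: bit_ext => p; rewrite bit_modn bit_0n.
      case: (ltnP p (a j)) => //= pj; apply/negP; apply: H' => //.
      by have := an j; lia.
    by have := bit_modn (a k) (a j) p; rewrite H' bit_0n pj /= => <-.
  rewrite E0; split=> [[H1 H2]|Hk].
    rewrite [RHS](divn_eq (a k) (2 ^ a j)) H2 addn0; congr (_ * _).
    apply: (leq_bits (n := n)) => // [|p pn]; first exact: leq_trans (leq_div _ _) _.
    by rewrite E H1.
  split=> [p pn|]; last by rewrite -Hk modnMl.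
  by rewrite -E -Hk mulnK ?expn_gt0.
by definability.
Qed.
#[local] Hint Resolve DB_mul_exp2 : definability.

Lemma bit_exp2 m i : bit (2 ^ m) i = (i == m).
Proof.
elim: m i => [|m IH] [|i]; rewrite ?bit_0 ?bit_S ?bit_0n //.
  by rewrite expnS mul2n odd_double.
by rewrite expnS mul2n doubleK IH.
Qed.

Lemma DB_exp2 N i j : DB N (fun n a => a i = 2 ^ a j).
Proof.
suff H : DB N (fun n a => forall p, p <= n -> (bit (a i) p <-> p = a j)).
  apply: (D_ext _ H) => n a _ an; split=> [H'|-> p _]; last first.
    by rewrite bit_exp2; split=> /eqP.
  apply: bit_ext => p; rewrite bit_exp2; case: (leqP p n) => pn.
    by apply/Bool.eq_iff_eq_true; apply: (iff_trans (H' p pn)); split=> /eqP.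
  rewrite (_ : p == a j = false); last by have := an j; lia.
  by apply/negP => /bit_lt; have := an i; lia.
by definability.
Qed.
#[local] Hint Resolve DB_exp2 : definability.

Lemma trunc_log_bitP m i : 0 < m ->
  (i = trunc_log 2 m <-> bit m i /\ forall j, i < j -> ~ bit m j).
Proof.
move=> m0; have /andP[lo hi] := trunc_log_bounds (isT : 1 < 2) m0.
have top : bit m (trunc_log 2 m).
  rewrite /bit (_ : m %/ 2 ^ trunc_log 2 m = 1) //.
  apply/eqP; rewrite eqn_leq -ltnS ltn_divLR ?expn_gt0 // -expnS hi /=.
  by rewrite divn_gt0 ?expn_gt0.
split=> [->|[bi H]].
  by split=> // j ij; rewrite bit_geq //; apply: leq_trans hi _; rewrite leq_pexp2l.
apply/eqP; rewrite eqn_leq -ltnS (bit_lt_exp hi bi) leqNgt /=.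
by apply/negP => /H; rewrite top.
Qed.

Lemma DB_trunc_log N i j : DB N (fun n a => a i = trunc_log 2 (a j)).
Proof.
suff H : DB N (fun n a => a j = 0 /\ a i = 0 \/
    ~ a j = 0 /\ bit (a j) (a i) /\ forall k, k <= n -> a i < k -> ~ bit (a j) k).
  apply: (D_ext _ H) => n a _ an.
  case: (posnP (a j)) => [->|j0]; first by rewrite trunc_log0; intuition.
  rewrite (trunc_log_bitP _ j0); split=> [[[]|[_ [b1 H2]]]|[b1 H2]]; first lia.
    split=> // k ik b2; apply: (H2 k) => //.
    by have := bit_lt b2; have := an j; lia.
  by right; split; [lia | split=> // k _; apply: H2].
by definability.
Qed.
#[local] Hint Resolve DB_trunc_log : definability.

Lemma DB_trunc_log_max N i : DB N (fun n a => a i = trunc_log 2 n).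
Proof.
suff H : DB N (fun n a => exists m, m <= n /\ ((forall v, v <= n -> v <= m) /\
   a i = trunc_log 2 m)).
  apply: (D_ext _ H) => n a _ an.
  split=> [[m [mn [H1 ->]]]|->]; last by exists n.
  by congr trunc_log; apply/eqP; rewrite eqn_leq mn H1.
by definability.
Qed.
#[local] Hint Resolve DB_trunc_log_max : definability.

Lemma DB_div_exp2 N i j k : DB N (fun n a => a i = a j %/ 2 ^ a k).
Proof.
suff H : DB N (fun n a => forall p, p <= n -> (bit (a i) p <->
    exists q, q <= n /\ (a k + p = q /\ bit (a j) q))).
  apply: (D_ext _ H) => n a _ an.
  have E p : bit (a j %/ 2 ^ a k) p <-> exists q, q <= n /\ (a k + p = q /\ bit (a j) q).
    rewrite bit_divn; split=> [b|[q [_ [-> ->]]] //].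
    by exists (a k + p); split=> //; have := bit_lt b; have := an j; lia.
  split=> [H'|-> p _]; last exact: E.
  apply: (leq_bits (n := n)) => // [|p pn]; first exact: leq_trans (leq_div _ _) _.
  by rewrite E H'.
by definability.
Qed.
#[local] Hint Resolve DB_div_exp2 : definability.

Lemma DB_half N i j : DB N (fun n a => a i = (a j)./2).
Proof.
suff H : DB N (fun n a => exists u, u <= n /\ (a i + a i = u /\ (u = a j \/ u.+1 = a j))).
  apply: (D_ext _ H) => n a _ an; split=> [[u [un [<-]]]|->]; first lia.
  by exists ((a j)./2 + (a j)./2); have := an j; lia.
by definability.
Qed.
#[local] Hint Resolve DB_half : definability.

(** * Recursion in FO(Bit) *)

(** Entry [t] occupies the [m] bits from position [t * m] on. *)
Lemma table_exists m T (s : nat -> nat) : (forall t, t < T -> s t < 2 ^ m) ->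
  exists2 w, w < 2 ^ (m * T) & forall t, t < T -> slice w (t * m) m = s t.
Proof.
move=> sm.
have [w wT bw] := exists_bits (fun i => bit (s (i %/ m)) (i %% m)) (m * T).
exists w => // t tT.
case: (posnP m) => [m0|m0].
  by move: (sm t tT); rewrite m0 /slice modn1; lia.
apply: bit_ext => i; rewrite bit_slice bw.
case: (ltnP i m) => im /=; last first.
  by apply/esym/bit_geq; apply: leq_trans (sm t tT) _; rewrite leq_pexp2l.
rewrite divnMDl // modnMDl divn_small // modn_small // addn0.
suff -> : t * m + i < m * T by [].
have : t.+1 * m <= T * m by rewrite leq_mul2r tT orbT.
by rewrite mulSn (mulnC m); lia.
Qed.

Section Recursion.
Variables (N : nat) (b : nat -> nat).
Hypothesis b_def : forall i, DB N (fun n a => a i = b n).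
Hypothesis b_leq : forall n, N <= n -> b n <= n.
Hypothesis width_leq : forall n, N <= n -> 2 ^ b n <= trunc_log 2 n.

Lemma value_leq n : N <= n -> 2 ^ (2 ^ b n) <= n.
Proof.
move=> Nn; have w := width_leq Nn.
have n0 : 0 < n.
  by case: n {Nn} w => //; rewrite trunc_log0; have := expn_gt0 2 (b 0); lia.
have /andP[lo _] := trunc_log_bounds (isT : 1 < 2) n0.
by apply: leq_trans lo; rewrite leq_pexp2l.
Qed.

(** The width of an entry is a power of two, so the position of entry [t] is a shift of [t] and
    multiplication is not presupposed. *)
Definition entry (n w t u : nat) : Prop :=
  exists e, e <= n /\ (e = b n /\ exists m, m <= n /\ (m = 2 ^ e /\
  exists p, p <= n /\ (t * 2 ^ e = p /\ u = slice w p m))).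

Lemma DB_entry i j k : DB N (fun n a => entry n (a i) (a j) (a k)).
Proof. by rewrite /entry; definability. Qed.

Lemma entryP n w t u : N <= n -> t * 2 ^ b n <= n ->
  (entry n w t u <-> u = slice w (t * 2 ^ b n) (2 ^ b n)).
Proof.
move=> Nn tn; split=> [[_ [_ [-> [_ [_ [-> [_ [_ [<-]]]]]]]]] //|->].
exists (b n); split; first exact: b_leq.
split=> //; exists (2 ^ b n); split; last by split=> //; exists (t * 2 ^ b n).
apply: leq_trans (value_leq Nn); exact: ltnW (ltn_expl _ _).
Qed.

(* The sequence s is a computation with T steps; its values are listed in a
   table w.  When w does not fit into the universe, the number of steps is
   halved by performing two steps at a time. *)
Lemma DB_rec k T (s : nat -> (nat -> nat) -> nat -> nat)
    (step : nat -> (nat -> nat) -> nat -> nat -> nat -> Prop) :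
    (forall n, N <= n -> T n <= n) ->
    (forall n, N <= n -> 2 ^ b n * T n <= 2 ^ k * (trunc_log 2 n - 2 ^ b n)) ->
    (forall n a t, N <= n -> (forall x, a x <= n) -> t <= T n -> s n a t < 2 ^ (2 ^ b n)) ->
    (forall n a t v, N <= n -> (forall x, a x <= n) -> t < T n -> v <= n ->
       (step n a t (s n a t) v <-> v = s n a t.+1)) ->
    (forall i, DB N (fun n a => a i <= T n)) ->
    DB N (fun n a => a 0 = s n (fun x => a x.+1) 0) ->
    DB N (fun n a => step n (fun x => a x.+3) (a 2) (a 1) (a 0)) ->
  DB N (fun n a => a 1 <= T n /\ a 0 = s n (fun x => a x.+2) (a 1)).
Proof.
elim: k T s step => [|k IH] T s step Tn Tk sb sS DT Ds0 DS.
  have small n a t : N <= n -> (forall x, a x <= n) -> t <= T n -> s n a t <= n.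
    move=> Nn an tT; have := sb n a t Nn an tT.
    by have := value_leq Nn; lia.
  suff H : DB N (fun n a => a 1 <= T n /\ exists w, w <= n /\
      ((forall t, t <= n -> t < a 1 -> forall u, u <= n -> forall v, v <= n ->
         forall t', t' <= n -> t.+1 = t' -> entry n w t u -> entry n w t' v ->
         step n (fun x => a x.+2) t u v)
      /\ (forall t, t <= n -> t = 0 -> forall u, u <= n -> entry n w t u ->
         u = s n (fun x => a x.+2) 0)
      /\ entry n w (a 1) (a 0))).
    apply: (D_ext _ H) => n a Nn an.
    pose a' x := a x.+2; have a'n x : a' x <= n by apply: an.
    have B0 : 0 < 2 ^ b n by rewrite expn_gt0.
    (* For [k = 0] a table of [(T n).+1] entries fits into [trunc_log 2 n] bits: the subtracted
       [2 ^ b n] is the room for the entry of step 0. *)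
    have wid := width_leq Nn; have := Tk n Nn; rewrite mul1n => BT.
    have wn : 2 ^ trunc_log 2 n <= n.
      apply: trunc_logP => //; have := value_leq Nn; have := expn_gt0 2 (2 ^ b n); lia.
    have pos t : t <= T n -> t * 2 ^ b n <= n.
      move=> tT; have : t * 2 ^ b n <= T n * 2 ^ b n by rewrite leq_mul2r tT orbT.
      by have := ltn_expl (trunc_log 2 n) (isT : 1 < 2); rewrite (mulnC (T n)); lia.
    have ent w t u : t <= T n -> (entry n w t u <-> u = slice w (t * 2 ^ b n) (2 ^ b n)).
      by move=> tT; apply: entryP => //; apply: pos.
    split=> -[aT]; last first.
      move=> a0; split=> //.
      have [t tT|w wT ws] := @table_exists (2 ^ b n) (T n).+1 (s n a').
        by apply: sb.
      have wn' : w <= n.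
        apply: leq_trans (ltnW wT) (leq_trans _ wn).
        by rewrite leq_pexp2l // mulnS; lia.
      exists w; split=> //; split; last split.
      - move=> t tn t1 u un v vn t' t'n <-; rewrite !ent; try lia.
        rewrite !ws; try lia.
        by move=> -> Ev; apply/sS => //; lia.
      - by move=> t tn -> u un; rewrite ent // ws.
      - by rewrite ent // ws.
    case=> w [wn' [H1 [H2 H3]]]; split=> //.
    have E t : t <= a 1 -> slice w (t * 2 ^ b n) (2 ^ b n) = s n a' t.
      have sw p m : slice w p m <= n by apply: leq_trans (slice_leq _ _ _) wn'.
      elim: t => [|t IHt] tle.
        by apply: (H2 0) => //; rewrite ent.
      have := H1 t _ tle _ (sw (t * 2 ^ b n) (2 ^ b n)) _ (sw (t.+1 * 2 ^ b n) (2 ^ b n)) t.+1.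
      have := Tn n Nn => Tnn.
      rewrite !ent; try lia; rewrite (IHt (ltnW tle)) => H4.
      by apply/sS => //; [lia | apply: H4 => //; lia].
    by move: H3; rewrite ent // E.
  apply: D_and; first exact: DT.
  have De := DB_entry.
  apply: D_ex; apply: D_and; last apply: D_and; last by definability.
  - definability.
    (* The variables [t'], [v], [u], [t], [w] have been bound in front of those of the goal, so
       [step] is read at 3, 2, 1 and its parameters start at 7. *)
    exact: (D_rename (fun x => if x is y.+3 then y.+4.+3 else x.+1) DS).
  - definability.
    exact: (D_rename (fun x => if x is y.+1 then y.+4.+1 else 0) Ds0).
have double_leq n t : t <= (T n)./2 -> t + t <= T n by lia.
(* [s'] runs through the even indices, and [step'] guesses the value in between. *)
pose s' n a t := s n a (t + t).
pose step' n a t u v := exists t2, t2 <= n /\ (t + t = t2 /\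
  exists t3, t3 <= n /\ (t2.+1 = t3 /\
  exists u', u' <= n /\ (step n a t2 u u' /\ step n a t3 u' v))).
have small n a t : N <= n -> (forall x, a x <= n) -> t <= T n -> s n a t <= n.
  by move=> Nn an tT; have := sb n a t Nn an tT; have := value_leq Nn; lia.
pose half n a t u := t <= (T n)./2 /\ u = s' n a t.
have D1 : DB N (fun n a => half n (fun x => a x.+2) (a 1) (a 0)).
  apply: (IH (fun n => (T n)./2) s' step').
  - by move=> n Nn; have := Tn n Nn; lia.
  - move=> n Nn; have := Tk n Nn; rewrite expnS -mulnA.
    have : 2 ^ b n * (T n)./2 * 2 <= 2 ^ b n * T n.
      by rewrite -mulnA leq_mul2l; apply/orP; right; lia.
    by lia.
  - by move=> n a t Nn an tT; apply: sb => //; apply: double_leq.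
  - move=> n a t v Nn an tT vn; rewrite /s' addSn addnS.
    have Tnn := Tn n Nn.
    split=> [[_ [_ [<- [_ [_ [<- [u' [u'n [S1 S2]]]]]]]]]|->].
      apply/(sS n a _ v) => //; first lia.
      by move/sS: S1 S2 => -> //; lia.
    exists (t + t); split; first lia.
    split=> //; exists (t + t).+1; split; first lia.
    split=> //; exists (s n a (t + t).+1); split; first by apply: small => //; lia.
    by split; apply/sS => //; try apply: small => //; lia.
  - move=> i.
    suff H : DB N (fun n a => exists u, u <= n /\ (a i + a i = u /\ u <= T n)).
      apply: (D_ext _ H) => n a Nn an; split=> [[u [_ [<-]]]|]; first lia.
      by exists (a i + a i); have := Tn n Nn; lia.
    have DT' i' : DB N (fun n a => a i' <= T n) by apply: DT.
    by definability.
  - exact: Ds0.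
  - rewrite /step'; definability.
      exact: (D_rename (fun x => match x with y.+3 => y.+4.+2 | 2 => 2 | 1 => 4 | _ => 0 end) DS).
    exact: (D_rename (fun x => match x with y.+3 => y.+4.+2 | 2 => 1 | 1 => 0 | _ => 3 end) DS).
(* An odd index is reached from the even one below it by one more step. *)
suff H : DB N (fun n a => a 1 <= T n /\ exists h, h <= n /\ exists u, u <= n /\
    (half n (fun x => a x.+2) h u /\
     exists t, t <= n /\ (h + h = t /\ (t = a 1 /\ a 0 = u \/
       t.+1 = a 1 /\ step n (fun x => a x.+2) t u (a 0))))).
  apply: (D_ext _ H) => n a Nn an.
  have a'n x : a x.+2 <= n by apply: an.
  split=> -[aT].
    case=> h [hn [u [un [[hT us] [t [tn [th Ht]]]]]]]; split=> //.
    move: us; rewrite /s' th => us.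
    case: Ht => [[<- ->] //|[t1 st]].
    by rewrite -t1; apply/sS => //; [lia | rewrite -us].
  move=> a0; split=> //; have Tnn := Tn n Nn; have aTn := an 1.
  exists (a 1)./2; split; first lia.
  exists (s' n (fun x => a x.+2) (a 1)./2).
  split; first by apply: small => //; lia.
  split; first by split=> //; lia.
  exists ((a 1)./2 + (a 1)./2); split; first lia.
  split=> //; case E: (odd (a 1)); [right|left].
    have E1 : ((a 1)./2 + (a 1)./2).+1 = a 1 by lia.
    split=> //; rewrite /s'; apply/sS => //; first lia.
    by rewrite E1.
  have E1 : (a 1)./2 + (a 1)./2 = a 1 by lia.
  by rewrite /s' E1.
apply: D_and; first exact: DT.
definability.
- exact: (D_rename (fun x => match x with y.+2 => y.+4 | 1 => 1 | _ => 0 end) D1).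
- exact: (D_rename (fun x => match x with y.+3 => y.+4.+1 | 2 => 0 | 1 => 1 | _ => 3 end) DS).
Qed.
End Recursion.

(** * Multiplication in FO(Bit) *)

Lemma modn_exp2D x m k : x %% 2 ^ (m + k) = x %% 2 ^ m + 2 ^ m * ((x %/ 2 ^ m) %% 2 ^ k).
Proof.
rewrite {1}(divn_eq (x %% 2 ^ (m + k)) (2 ^ m)) addnC mulnC; congr (_ + _ * _).
  by apply: bit_ext => i; rewrite !bit_modn; case: ltnP => //= im; rewrite ltn_addr.
by apply: bit_ext => i; rewrite bit_divn !bit_modn bit_divn ltn_add2l.
Qed.

(* The base is 2 ^ 2 ^ k, so that the position of a digit is a shift of its index. *)
Section Schoolbook.
Variable k : nat.
Local Notation K := (2 ^ k).
Definition digit (w t : nat) : nat := slice w (t * K) K.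
(** [t] counts the products added so far, so that a column sum is itself computed by recursion.
    Column [c] is complete at [t = c.+1], and the factor [i <= c] cancels later terms. *)
Definition column (x y c t : nat) : nat :=
  \sum_(i < t) (i <= c) * (digit x i * digit y (c - i)).
(** The carry into column [t]; it may be longer than one digit. *)
Fixpoint carry_digit (x y t : nat) : nat :=
  if t is c.+1 then (carry_digit x y c + column x y c c.+1) %/ 2 ^ K else 0.

Lemma digit_lt w t : digit w t < 2 ^ K.
Proof. by rewrite ltn_pmod ?expn_gt0. Qed.

Lemma mod_digit w t : w %% 2 ^ (t.+1 * K) = w %% 2 ^ (t * K) + 2 ^ (t * K) * digit w t.
Proof. by rewrite mulSn addnC modn_exp2D. Qed.

(** Pairs of digits whose indices sum to less than [m] are regrouped by the digit of [x]: the
    partners of digit [i] make up [y] truncated to [m - i] digits. *)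
Lemma partial_columns x y m :
  \sum_(c < m) column x y c c.+1 * 2 ^ (c * K) =
  \sum_(i < m) digit x i * 2 ^ (i * K) * (y %% 2 ^ ((m - i) * K)).
Proof.
elim: m => [|m IH]; first by rewrite !big_ord0.
rewrite big_ord_recr /= IH [RHS]big_ord_recr /= subSnn mul1n.
have -> : \sum_(i < m) digit x i * 2 ^ (i * K) * (y %% 2 ^ ((m.+1 - i) * K)) =
    \sum_(i < m) digit x i * 2 ^ (i * K) * (y %% 2 ^ ((m - i) * K)) +
    \sum_(i < m) digit x i * digit y (m - i) * 2 ^ (m * K).
  rewrite -big_split /=; apply: eq_bigr => i _.
  rewrite subSn ?(ltnW (ltn_ord i)) // mod_digit mulnDr; congr (_ + _).
  have -> : 2 ^ (m * K) = 2 ^ (i * K) * 2 ^ ((m - i) * K).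
    by rewrite -expnD -mulnDl subnKC // ltnW.
  by rewrite -!mulnA; congr (_ * _); rewrite mulnA mulnC.
rewrite -addnA; congr (_ + _).
rewrite /column big_ord_recr /= leqnn subnn mul1n mulnDl -big_distrl /=; congr (_ + _).
  by congr (_ * _); apply: eq_bigr => i _; rewrite ltnW // mul1n.
by rewrite -mulnA (mulnC (digit y 0)) mulnA /digit /slice mul0n divn1.
Qed.

(** Truncating [y] to [m - i] digits does not change [digit x i * 2 ^ (i * K) * y] modulo
    [2 ^ (m * K)]. *)
Lemma mod_columns x y m :
  x * y = \sum_(c < m) column x y c c.+1 * 2 ^ (c * K) %[mod 2 ^ (m * K)].
Proof.
rewrite partial_columns.
have Ex : x %% 2 ^ (m * K) = \sum_(i < m) digit x i * 2 ^ (i * K).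
  elim: m => [|m IH]; first by rewrite big_ord0 modn1.
  by rewrite big_ord_recr /= mod_digit IH (mulnC (digit x m)).
rewrite -modnMml Ex big_distrl /= -modn_summ -[RHS]modn_summ; congr (_ %% _).
apply: eq_bigr => i _.
have -> : m * K = (m - i) * K + i * K by rewrite -mulnDl subnK // ltnW.
rewrite -!mulnA expnD (mulnC (2 ^ ((m - i) * K))).
have E z : (digit x i * (2 ^ (i * K) * z)) %% (2 ^ (i * K) * 2 ^ ((m - i) * K)) =
           2 ^ (i * K) * ((digit x i * z) %% 2 ^ ((m - i) * K)).
  by rewrite mulnCA muln_modr.
by rewrite !E modnMmr.
Qed.

Lemma carry_digitE x y c :
  carry_digit x y c = (\sum_(j < c) column x y j j.+1 * 2 ^ (j * K)) %/ 2 ^ (c * K).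
Proof.
elim: c => [|c IH] /=; first by rewrite big_ord0 div0n.
by rewrite big_ord_recr /= mulSnr expnD divnMA [X in X %/ 2 ^ (c * K)]addnC divnMDl ?expn_gt0 // -IH addnC.
Qed.

(** Columns above [c] do not affect digit [c], and those below act only through their carry. A
    product can therefore be checked digit by digit. *)
Lemma digit_mul x y c :
  digit (x * y) c = digit (carry_digit x y c + column x y c c.+1) 0.
Proof.
have E w : digit w c = (w %% 2 ^ (c.+1 * K)) %/ 2 ^ (c * K).
  by apply: bit_ext => i; rewrite bit_slice bit_divn bit_modn mulSnr ltn_add2l.
rewrite E (mod_columns x y c.+1) -E big_ord_recr /= /digit /slice.
by rewrite mul0n divn1 [X in X %/ _]addnC divnMDl ?expn_gt0 // carry_digitE addnC.
Qed.

Lemma eq_digits m x y : x < 2 ^ (m * K) -> y < 2 ^ (m * K) ->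
  (forall c, c < m -> digit x c = digit y c) -> x = y.
Proof.
move=> xm ym H; apply: bit_ext => i.
have K0 : 0 < K by rewrite expn_gt0.
case: (ltnP i (m * K)) => im; last first.
  by rewrite !bit_geq //; [apply: leq_trans ym _ | apply: leq_trans xm _];
    rewrite leq_pexp2l.
have E z : bit z i = bit (digit z (i %/ K)) (i %% K).
  by rewrite bit_slice ltn_pmod // -divn_eq.
by rewrite !E H // ltn_divLR.
Qed.

Lemma columnS x y c t :
  column x y c t.+1 = column x y c t + (t <= c) * (digit x t * digit y (c - t)).
Proof. by rewrite /column big_ord_recr. Qed.

Lemma column_leq x y c t : column x y c t <= t * 2 ^ (2 * K).
Proof.
elim: t => [|t IH]; first by rewrite /column big_ord0.
rewrite columnS mulSn addnC leq_add //.
apply: leq_trans (_ : digit x t * digit y (c - t) <= _).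
  by case: (t <= c); rewrite ?mul1n.
by rewrite mul2n -addnn expnD leq_mul // ltnW // digit_lt.
Qed.

Lemma carry_digit_leq x y T t : t <= T -> carry_digit x y t <= T * 2 ^ (2 * K).
Proof.
elim: t => // t IH tT /=; have {}IH := IH (ltnW tT).
have C : column x y t t.+1 <= T * 2 ^ (2 * K).
  by apply: leq_trans (column_leq _ _ _ _) _; rewrite leq_mul2r tT orbT.
(* The base is at least 2, so the division at least halves a sum of two terms that obey the same
   bound. *)
have K2 : 2 <= 2 ^ K by rewrite -{1}(expn1 2) leq_pexp2l // expn_gt0.
apply: leq_trans (leq_div2l _ _ K2) _ => //; lia.
Qed.
End Schoolbook.

(* The digits have about sqrt (log n) bits, so that a table of that many
   digits is coded by boundedly many elements of the universe. *)
Definition base_exp (n : nat) : nat := (trunc_log 2 (trunc_log 2 n))./2.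
Local Notation digit_size n := (2 ^ base_exp n).

Section Multiplication.
Variable N : nat.
Hypothesis N_large : forall n, N <= n -> 256 <= trunc_log 2 n.

(** The digit size is 2 to half the logarithm of [trunc_log 2 n]; the two roundings cost less than a
    factor 4 in its square. From [256 = 2 ^ 8] comes [16 = 2 ^ 4]. *)
Lemma digit_sizeP n : N <= n ->
  [/\ 16 <= digit_size n, digit_size n * digit_size n <= trunc_log 2 n
    & trunc_log 2 n < 4 * (digit_size n * digit_size n)].
Proof.
move=> /N_large L256; set L := trunc_log 2 n in L256 *.
have L0 : 0 < L by lia.
have /andP[lo hi] := trunc_log_bounds (isT : 1 < 2) L0.
have l8 : 8 <= trunc_log 2 L.
  by rewrite -ltnS -(ltn_exp2l _ _ (isT : 1 < 2)); apply: leq_ltn_trans hi.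
rewrite /base_exp -/L -expnD addnn; split.
- by rewrite -[16]/(2 ^ 4) leq_exp2l //; lia.
- by apply: leq_trans lo; rewrite leq_exp2l //; lia.
- by apply: leq_trans hi _; rewrite -[4]/(2 ^ 2) -expnD leq_exp2l //; lia.
Qed.

(** The factor 8 serves twice: entries of [8 * digit_size n] bits hold column sums and carries, and
    as many digits hold any product of two elements. *)
Lemma digit_size_width n : 2 ^ (base_exp n + 3) = 8 * digit_size n.
Proof. by rewrite expnD mulnC. Qed.

Lemma large_leq n : N <= n -> 8 * trunc_log 2 n <= n.
Proof.
move=> Nn; have L256 := N_large Nn; set L := trunc_log 2 n in L256 *.
have wn : 2 ^ L <= n.
  by apply: trunc_logP => //; case: n @L {Nn} L256 => //; rewrite /= trunc_log0.
apply: leq_trans wn; have -> : L = (L - 256) + 256 by lia.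
elim: (L - 256) => [|m IH]; last by rewrite addSn expnS; lia.
by rewrite add0n -[8 * 256]/(2 ^ 11) leq_exp2l.
Qed.

Lemma width_ltn n : N <= n -> 2 ^ (base_exp n + 3) <= trunc_log 2 n.
Proof.
move=> Nn; have [K16 KL _] := digit_sizeP Nn; rewrite digit_size_width.
by apply: leq_trans KL; rewrite leq_mul2r; lia.
Qed.

Lemma base_exp_leq n : N <= n -> base_exp n + 3 <= n.
Proof.
move=> Nn; have := width_ltn Nn; have := ltn_expl (base_exp n + 3) (isT : 1 < 2).
by have := large_leq Nn; lia.
Qed.

Lemma DB_base_exp i : DB N (fun n a => a i = base_exp n).
Proof.
suff H : DB N (fun n a => exists u, u <= n /\ (u = trunc_log 2 n /\
    exists v, v <= n /\ (v = trunc_log 2 u /\ a i = v./2))).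
  apply: (D_ext _ H) => n a Nn _; split=> [[_ [_ [-> [_ [_ [->]]]]]] //|->].
  have Ln := large_leq Nn.
  have L2 : trunc_log 2 (trunc_log 2 n) <= trunc_log 2 n.
    have L0 : 0 < trunc_log 2 n by have := N_large Nn; lia.
    have := trunc_logP (isT : 1 < 2) L0.
    by have := ltn_expl (trunc_log 2 (trunc_log 2 n)) (isT : 1 < 2); lia.
  exists (trunc_log 2 n); split; first by lia.
  by split=> //; exists (trunc_log 2 (trunc_log 2 n)); split; first by lia.
by definability.
Qed.
#[local] Hint Resolve DB_base_exp : definability.

Lemma DB_width i : DB N (fun n a => a i = base_exp n + 3).
Proof.
suff H : DB N (fun n a => exists u, u <= n /\ (u = base_exp n /\
    exists v, v <= n /\ (v = 3 /\ u + v = a i))).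
  apply: (D_ext _ H) => n a Nn _; split=> [[_ [_ [-> [_ [_ [->]]]]]] //|->].
  have := base_exp_leq Nn; exists (base_exp n); split; first lia.
  by split=> //; exists 3; split; first lia.
by definability.
Qed.
#[local] Hint Resolve DB_width : definability.

Lemma DB_digit_size i : DB N (fun n a => a i = digit_size n).
Proof.
suff H : DB N (fun n a => exists u, u <= n /\ (u = base_exp n /\ a i = 2 ^ u)).
  apply: (D_ext _ H) => n a Nn _; split=> [[_ [_ [->]]] //|->].
  by have := base_exp_leq Nn; exists (base_exp n); split; first lia.
by definability.
Qed.
#[local] Hint Resolve DB_digit_size : definability.

Lemma digit_size_leq n : N <= n -> 8 * digit_size n <= n.
Proof. by move=> Nn; have := width_ltn Nn; rewrite digit_size_width; have := large_leq Nn; lia. Qed.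

Lemma DB_leq_width i : DB N (fun n a => a i <= 8 * digit_size n).
Proof.
suff H : DB N (fun n a => exists u, u <= n /\ (u = base_exp n + 3 /\
    exists v, v <= n /\ (v = 2 ^ u /\ a i <= v))).
  apply: (D_ext _ H) => n a Nn _.
  rewrite -digit_size_width; split=> [[_ [_ [-> [_ [_ [->]]]]]] //|ai].
  exists (base_exp n + 3); split; first exact: base_exp_leq.
  split=> //; exists (2 ^ (base_exp n + 3)).
  by split; first by rewrite digit_size_width digit_size_leq.
by definability.
Qed.
#[local] Hint Resolve DB_leq_width : definability.

Lemma DB_leq_digit_size i : DB N (fun n a => a i <= digit_size n).
Proof.
suff H : DB N (fun n a => exists u, u <= n /\ (u = digit_size n /\ a i <= u)).
  apply: (D_ext _ H) => n a Nn _; split=> [[_ [_ [->]]] //|ai].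
  by have := digit_size_leq Nn; exists (digit_size n); split; first lia.
by definability.
Qed.
#[local] Hint Resolve DB_leq_digit_size : definability.

Lemma DB_digit_rec T (s : nat -> (nat -> nat) -> nat -> nat)
    (step : nat -> (nat -> nat) -> nat -> nat -> nat -> Prop) :
    (forall n, N <= n -> T n <= 8 * digit_size n) ->
    (forall n a t, N <= n -> (forall x, a x <= n) -> t <= T n -> s n a t < 2 ^ (8 * digit_size n)) ->
    (forall n a t v, N <= n -> (forall x, a x <= n) -> t < T n -> v <= n ->
       (step n a t (s n a t) v <-> v = s n a t.+1)) ->
    (forall i, DB N (fun n a => a i <= T n)) ->
    (forall n a, s n a 0 = 0) ->
    DB N (fun n a => step n (fun x => a x.+3) (a 2) (a 1) (a 0)) ->
  DB N (fun n a => a 1 <= T n /\ a 0 = s n (fun x => a x.+2) (a 1)).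
Proof.
move=> TK sb sS DT s0 DS.
(* With [K = digit_size n] and [L = trunc_log 2 n], width times steps is at most [64 K^2]. Since
   [16 K <= K^2 <= L], one has [L - 8 K >= K^2 / 2], so seven halvings suffice. *)
apply: (DB_rec (b := fun n => base_exp n + 3) DB_width base_exp_leq width_ltn (k := 7)
  (step := step)) => //.
- by move=> n Nn; apply: leq_trans (TK n Nn) (digit_size_leq Nn).
- move=> n Nn; rewrite digit_size_width; have [K16 KL _] := digit_sizeP Nn.
  apply: leq_trans (leq_mul (leqnn _) (TK n Nn)) _.
  have K16' : 16 * digit_size n <= digit_size n * digit_size n by rewrite leq_mul2r K16 orbT.
  rewrite (_ : 2 ^ 7 = 128) //; move: KL K16'; set q := digit_size n * _.
  by rewrite (_ : 8 * _ * (8 * _) = 64 * q) ?/q; [lia | rewrite /q; lia].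
- by move=> n a t Nn an tT; rewrite digit_size_width; apply: sb.
- have H : DB N (fun n a => a 0 = 0) by definability.
  by apply: (D_ext _ H) => n a _ _; rewrite s0.
Qed.

Lemma value_bound n m : N <= n -> m < 2 ^ (8 * digit_size n) -> m <= n.
Proof.
move=> Nn mK; have := width_ltn Nn; rewrite digit_size_width => KL.
have n0 : 0 < n by have := digit_size_leq Nn; have := expn_gt0 2 (base_exp n); lia.
have := trunc_logP (isT : 1 < 2) n0.
by have := leq_pexp2l (isT : 0 < 2) KL; lia.
Qed.

(** A digit whose position exceeds [n] lies beyond all bits of [a j] and is 0; the formula treats
    this case separately. *)
Lemma DB_digit i j k : DB N (fun n a => a i = digit (base_exp n) (a j) (a k)).
Proof.
suff H : DB N (fun n a => exists e, e <= n /\ (e = base_exp n /\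
    exists m, m <= n /\ (m = digit_size n /\
     ((exists p, p <= n /\ (a k * 2 ^ e = p /\ a i = slice (a j) p m)) \/
      ~ (exists p, p <= n /\ a k * 2 ^ e = p) /\ a i = 0)))).
  apply: (D_ext _ H) => n a Nn an.
  have Kn := digit_size_leq Nn; have bn := base_exp_leq Nn.
  have big : n < a k * 2 ^ base_exp n -> digit (base_exp n) (a j) (a k) = 0.
    move=> kn; rewrite /digit /slice divn_small ?mod0n //.
    apply: leq_ltn_trans (an j) (ltn_trans kn (ltn_expl _ _)) => //.
  split=> [[_ [_ [-> [_ [_ [-> [[p [_ [<-]]] //|[np ->]]]]]]]]|->].
    rewrite big // ltnNge; apply/negP => kn; apply: np.
    by exists (a k * 2 ^ base_exp n).
  exists (base_exp n); split; first lia.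
  split=> //; exists (digit_size n); split; first lia.
  split=> //; case: (leqP (a k * 2 ^ base_exp n) n) => kn.
    by left; exists (a k * 2 ^ base_exp n).
  by right; rewrite big //; split=> // -[p [pn pk]]; lia.
by definability.
Qed.
#[local] Hint Resolve DB_digit : definability.

(** Passing to digit 0 bounds the product for arbitrary arguments, as the recursion demands a bound
    under every assignment. *)
Definition digit_prod (n x y : nat) : nat :=
  digit (base_exp n) x 0 * digit (base_exp n) y 0.

(** Shift and add: after [t] steps the digit is multiplied by the lowest [t] bits of the other
    factor, and after [digit_size n] steps these bits form its digit 0. *)
Lemma DB_digit_prod i j k : DB N (fun n a => a i = digit_prod n (a j) (a k)).
Proof.
pose s n (a : nat -> nat) t := digit (base_exp n) (a 0) 0 * slice (a 1) 0 t.
pose step n (a : nat -> nat) t u v :=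
  bit (a 1) t /\ (exists z, z <= n /\ (z = 0 /\
    exists x, x <= n /\ (x = digit (base_exp n) (a 0) z /\
    exists e, e <= n /\ (x * 2 ^ t = e /\ u + e = v)))) \/ ~ bit (a 1) t /\ v = u.
pose R n a t u := t <= digit_size n /\ u = s n a t.
have DR : DB N (fun n a => R n (fun x => a x.+2) (a 1) (a 0)).
  apply: (DB_digit_rec (s := s) (step := step)).
  - by move=> n Nn; lia.
  - move=> n a t Nn an tK; rewrite /s.
    apply: leq_trans (_ : 2 ^ (2 * digit_size n) <= _); last first.
      by rewrite leq_exp2l //; lia.
    have h1 := digit_lt (base_exp n) (a 0) 0.
    have h2 : slice (a 1) 0 t <= 2 ^ digit_size n.
      apply: leq_trans (ltnW (ltn_pmod _ (expn_gt0 2 t))) _.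
      by rewrite leq_exp2l.
    rewrite mul2n -addnn expnD; apply: leq_ltn_trans (leq_mul (leqnn _) h2) _.
    by rewrite ltn_mul2r expn_gt0.
  - move=> n a t v Nn an tK vn; rewrite /step /s.
    set d := digit _ _ _.
    have -> : slice (a 1) 0 t.+1 = slice (a 1) 0 t + 2 ^ t * bit (a 1) t.
      by rewrite /slice -[t.+1]addn1 modn_exp2D expn0 divn1 modn2.
    rewrite mulnDr; case: (bit (a 1) t) => /=; last first.
      by rewrite !muln0 addn0; intuition.
    rewrite muln1; split=> [[[_ [_ [_ [-> [_ [_ [-> [_ [_ [<- <-]]]]]]]]]]|[]] //|Ev].
    left; split=> //; exists 0; split=> //; split=> //.
    exists d; split; first exact: leq_trans (slice_leq _ _ _) _.
    by split=> //; exists (d * 2 ^ t); split; first lia.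
  - by move=> i'; apply: DB_leq_digit_size.
  - by move=> n a; rewrite /s /slice modn1 muln0.
  - by rewrite /step; definability.
suff H : DB N (fun n a => exists t, t <= n /\ (t = digit_size n /\
    R n (fun x => if x is 0 then a j else a k) t (a i))).
  apply: (D_ext _ H) => n a Nn an.
  have E : slice (a k) 0 (digit_size n) = digit (base_exp n) (a k) 0.
    by rewrite /digit mul0n.
  split=> [[_ [_ [-> [_ ->]]]]|->]; first by rewrite /s /= E.
  exists (digit_size n); split; first by have := digit_size_leq Nn; lia.
  by split=> //; split=> //; rewrite /s /= E.
definability.
by apply: (D_rename (fun x => match x with 0 => i.+1 | 1 => 0 | 2 => j.+1 | _ => k.+1 end) DR).
Qed.
#[local] Hint Resolve DB_digit_prod : definability.

(** With [K = digit_size n], a carry and a column sum are each at most [8 K] times [2 ^ (2 K)],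
    hence the 16. The bound follows from [16 K < 2 ^ (4 + K)] and [4 + 3 K < 8 K]. *)
Lemma state_bound n : N <= n ->
  16 * digit_size n * 2 ^ (2 * digit_size n) < 2 ^ (8 * digit_size n).
Proof.
move=> Nn; have [K16 _ _] := digit_sizeP Nn; set K := digit_size n in K16 *.
apply: leq_ltn_trans (_ : 2 ^ 4 * 2 ^ K * 2 ^ (2 * K) < _).
  by rewrite leq_mul2r leq_mul2l ltnW ?orbT // ltn_expl.
by rewrite -!expnD ltn_exp2l //; lia.
Qed.

Definition column_rel (n x y c u : nat) : Prop :=
  c < 8 * digit_size n /\ u = column (base_exp n) x y c c.+1.

Lemma digit_digit k w t : digit k (digit k w t) 0 = digit k w t.
Proof. by rewrite {1}/digit /slice mul0n divn1 modn_small ?digit_lt. Qed.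

Lemma DB_column i j k m : DB N (fun n a => column_rel n (a i) (a j) (a k) (a m)).
Proof.
pose s n (a : nat -> nat) t := column (base_exp n) (a 0) (a 1) (a 2) t.
pose step n (a : nat -> nat) t u v :=
  t <= a 2 /\ (exists d, d <= n /\ (d = digit (base_exp n) (a 0) t /\
    exists c, c <= n /\ (a 2 - t = c /\
    exists e, e <= n /\ (e = digit (base_exp n) (a 1) c /\
    exists f, f <= n /\ (f = digit_prod n d e /\ u + f = v))))) \/ ~ t <= a 2 /\ v = u.
pose R n a t u := t <= 8 * digit_size n /\ u = s n a t.
have DR : DB N (fun n a => R n (fun x => a x.+2) (a 1) (a 0)).
  apply: (DB_digit_rec (s := s) (step := step)).
  - by [].
  - move=> n a t Nn an tK; apply: leq_ltn_trans (state_bound Nn).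
    apply: leq_trans (column_leq _ _ _ _ _) _; rewrite leq_mul2r; lia.
  - move=> n a t v Nn an tK vn; rewrite /step /s.
    rewrite columnS.
    case: (t <= a 2) => /=; last by rewrite addn0; intuition.
    rewrite mul1n; split=> [[[_ [_ [_ [-> [_ [_ [<- [_ [_ [-> [_ [_ [-> <-]]]]]]]]]]]]]|[]] //|Ev].
      by rewrite /digit_prod !digit_digit.
    left; split=> //; exists (digit (base_exp n) (a 0) t).
    split; first exact: leq_trans (slice_leq _ _ _) _.
    split=> //; exists (a 2 - t); split; first by have := an 2; lia.
    split=> //; exists (digit (base_exp n) (a 1) (a 2 - t)).
    split; first exact: leq_trans (slice_leq _ _ _) _.
    split=> //; exists (digit_prod n (digit (base_exp n) (a 0) t)
      (digit (base_exp n) (a 1) (a 2 - t))).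
    by rewrite /digit_prod !digit_digit; split=> //; lia.
  - by move=> i'; apply: DB_leq_width.
  - by move=> n a; rewrite /s /column big_ord0.
  - by rewrite /step; definability.
suff H : DB N (fun n a => exists t, t <= n /\ ((a k).+1 = t /\
    R n (fun x => match x with 0 => a i | 1 => a j | _ => a k end) t (a m))).
  apply: (D_ext _ H) => n a Nn an; rewrite /column_rel.
  split=> [[_ [_ [<- [h1 h2]]]] //|[h1 h2]].
  exists (a k).+1; split; first by have := digit_size_leq Nn; lia.
  by [].
definability.
by apply: (D_rename (fun x => match x with
  0 => m.+1 | 1 => 0 | 2 => i.+1 | 3 => j.+1 | _ => k.+1 end) DR).
Qed.
#[local] Hint Resolve DB_column : definability.

Definition carry_rel (n x y t u : nat) : Prop :=
  t <= 8 * digit_size n /\ u = carry_digit (base_exp n) x y t.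

Lemma carry_column_leq n x y c : N <= n -> c < 8 * digit_size n ->
  carry_digit (base_exp n) x y c + column (base_exp n) x y c c.+1 <= n.
Proof.
move=> Nn cK; apply: (value_bound Nn); apply: leq_ltn_trans (state_bound Nn).
have h1 := carry_digit_leq (base_exp n) x y (ltnW cK).
have h2 : column (base_exp n) x y c c.+1 <= 8 * digit_size n * 2 ^ (2 * digit_size n).
  by apply: leq_trans (column_leq _ _ _ _ _) _; rewrite leq_mul2r cK orbT.
by apply: leq_trans (leq_add h1 h2) _; rewrite -!mulnDl.
Qed.

Lemma DB_carry i j k m : DB N (fun n a => carry_rel n (a i) (a j) (a k) (a m)).
Proof.
pose s n (a : nat -> nat) t := carry_digit (base_exp n) (a 0) (a 1) t.
pose step n (a : nat -> nat) t u v :=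
  exists c, c <= n /\ (column_rel n (a 0) (a 1) t c /\
  exists g, g <= n /\ (u + c = g /\
  exists K, K <= n /\ (K = digit_size n /\ v = g %/ 2 ^ K))).
have DR : DB N (fun n a => carry_rel n (a 2) (a 3) (a 1) (a 0)).
  apply: (DB_digit_rec (s := s) (step := step)).
  - by [].
  - move=> n a t Nn an tK; apply: leq_ltn_trans (state_bound Nn).
    by apply: leq_trans (carry_digit_leq _ _ _ tK) _; rewrite leq_mul2r; lia.
  - move=> n a t v Nn an tK vn; rewrite /step /s /=.
    split=> [[_ [_ [[_ ->] [_ [_ [<- [_ [_ [-> ->]]]]]]]]] //|Ev].
    have := carry_column_leq (a 0) (a 1) Nn tK => h.
    exists (column (base_exp n) (a 0) (a 1) t t.+1); split; first lia.
    split=> //; exists (carry_digit (base_exp n) (a 0) (a 1) t +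
      column (base_exp n) (a 0) (a 1) t t.+1); split=> //.
    by split=> //; exists (digit_size n); split; first by have := digit_size_leq Nn; lia.
  - by move=> i'; apply: DB_leq_width.
  - by [].
  - by rewrite /step; definability.
by apply: (D_rename (fun x => match x with 0 => m | 1 => k | 2 => i | _ => j end) DR).
Qed.
#[local] Hint Resolve DB_carry : definability.

(** The product may exceed [n] and is never named as an element: each digit of [a k] is compared
    with the digit left by the carry and the column sum. *)
Lemma DB_muln i j k : DB N (fun n a => a i * a j = a k).
Proof.
suff H : DB N (fun n a => forall c, c <= n -> forall s, s <= n ->
    column_rel n (a i) (a j) c s -> forall g, g <= n -> carry_rel n (a i) (a j) c g ->
    forall h, h <= n -> g + s = h -> forall z, z <= n -> z = 0 ->
    forall d, d <= n -> d = digit (base_exp n) (a k) c -> d = digit (base_exp n) h z).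
  apply: (D_ext _ H) => n a Nn an; split=> [H'|E].
    have [_ _ KL] := digit_sizeP Nn.
    have nL : n < 2 ^ (trunc_log 2 n).+1 by apply: trunc_log_ltn.
    (* With [K] the digit size, each factor has at most [(trunc_log 2 n).+1 <= 4 K^2] bits, so the
       product fits into [8 K] digits of [K] bits. *)
    have nn x : x <= n * n -> x < 2 ^ (8 * digit_size n * digit_size n).
      move=> xn; apply: leq_ltn_trans xn _.
      apply: leq_trans (_ : 2 ^ (trunc_log 2 n).+1 * 2 ^ (trunc_log 2 n).+1 <= _).
        by apply: ltn_mul.
      by rewrite -expnD leq_exp2l // -mulnA; lia.
    apply: (@eq_digits (base_exp n) (8 * digit_size n)).
    - by apply: nn; apply: leq_mul.
    - apply: nn; apply: leq_trans (an k) _.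
      by case: n {Nn an H' KL nL} => // n; rewrite leq_pmulr.
    move=> c cK; have h := carry_column_leq (a i) (a j) Nn cK.
    have Kn := digit_size_leq Nn.
    rewrite digit_mul; apply/esym; apply: (H' c _ (column (base_exp n) (a i) (a j) c c.+1) _ _
      (carry_digit (base_exp n) (a i) (a j) c)) => //; try lia.
    - by split=> //; lia.
    - exact: leq_trans (slice_leq _ _ _) _.
  move=> c _ _ _ [_ ->] _ _ [_ ->] _ _ <- _ _ -> _ _ ->.
  by rewrite -E digit_mul.
by definability.
Qed.

End Multiplication.

(** * Columns and rows *)

Lemma tri_double i : tri i + tri i = i * i.+1.
Proof.
rewrite addnn -muln2 /tri divnK // dvdn2 oddM /=; by case: (odd i).
Qed.

Lemma triS i : tri i.+1 = tri i + i.+1.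
Proof. by have := tri_double i; have := tri_double i.+1; nia. Qed.

Lemma tri_mono i j : i <= j -> tri i <= tri j.
Proof. by move=> /subnK <-; elim: (j - i) => // k IH; rewrite addSn triS; lia. Qed.

Lemma tri_geq i : i <= tri i.
Proof. by elim: i => // i IH; rewrite triS; lia. Qed.

Lemma tri_lt_exp i : tri i < 2 ^ i.
Proof.
case: i => [|[|[|[|]]]] // i; elim: i => // i IH.
by rewrite triS expnS; have := tri_geq i.+4; have := tri_double i.+4; nia.
Qed.

Lemma col_bounds x : tri (col x) <= x < tri (col x).+1.
Proof.
have [c [c1 c2]] : exists c, tri c <= x /\ x < tri c.+1.
  elim: x => [|x [c [c1 c2]]]; first by exists 0.
  case: (ltnP x.+1 (tri c.+1)) => h; [exists c | exists c.+1]; rewrite ?[tri c.+2]triS; lia.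
suff -> : col x = c by rewrite c1.
have cx : c < x.+1 by have := tri_geq c; lia.
apply/eqP; rewrite eqn_leq; apply/andP; split.
  apply/bigmax_leqP => i ix; rewrite leqNgt; apply/negP => /tri_mono ci; lia.
by rewrite /col (bigmax_sup (Ordinal cx)).
Qed.

Lemma col_eq x c : tri c <= x -> x < tri c.+1 -> col x = c.
Proof.
move=> c1 c2; have /andP[h1 h2] := col_bounds x.
apply/eqP; rewrite eqn_leq; apply/andP; split; rewrite leqNgt; apply/negP => /tri_mono; lia.
Qed.

Lemma col_row x : tri (col x) + row x = x.
Proof. by rewrite /row /qof; have /andP[] := col_bounds x; lia. Qed.

Lemma row_leq_col x : row x <= col x.
Proof. by have := col_row x; have /andP[_] := col_bounds x; rewrite triS; lia. Qed.

Lemma col_tri c r : r <= c -> col (tri c + r) = c.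
Proof. by move=> rc; apply: col_eq; rewrite ?triS; lia. Qed.

Lemma row_tri c r : r <= c -> row (tri c + r) = r.
Proof. by move=> rc; have := col_row (tri c + r); rewrite col_tri //; lia. Qed.

Lemma col_rowP x c r : (c = col x /\ r = row x) <-> (tri c + r = x /\ r <= c).
Proof.
split=> [[-> ->]|[<- rc]]; first by rewrite col_row row_leq_col.
by rewrite col_tri // row_tri.
Qed.

(** * Finite disjunctions and the removal of the size threshold *)

Lemma D_prop l N (Q : Prop) : definable l N (fun n a => Q).
Proof.
by case: (classic Q) => q; [apply: (D_ext _ (D_const l N true)) | apply: (D_ext _ (D_const l N false))];
  move=> n a _ _; split.
Qed.

(** [k] ranges over a fixed finite set and not over the universe, so the formula is a disjunction
    with [m] members. *)
Lemma D_bounded_or l N m (P : nat -> nat -> (nat -> nat) -> Prop) :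
  (forall k, definable l N (P k)) -> definable l N (fun n a => exists k, k < m /\ P k n a).
Proof.
move=> DP; elim: m => [|m IH].
  by apply: (D_ext _ (D_prop l N False)) => n a _ _; split=> // -[k []].
apply: (D_ext _ (D_or IH (DP m))) => n a _ _; split=> [[[k [km Pk]]|Pm]|[k [km Pk]]].
- by exists k; split=> //; lia.
- by exists m.
- case: (ltngtP k m) => [km'|mk|Ek]; [by left; exists k | by lia | by right; rewrite -Ek].
Qed.

(* Each of the finitely many sizes below N is definable, and over it every
   relation is a finite set of definable pairs. *)
Lemma D_all_sizes l N (R : nat -> nat -> nat -> Prop) :
    (forall i j, definable l 0 (fun n a => a i < a j)) ->
    definable l N (fun n a => R n (a 0) (a 1)) ->
  definable l 0 (fun n a => R n (a 0) (a 1)).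
Proof.
move=> Dlt; elim: N => // N IH [f [wff sf]]; apply: IH.
have weaken P : definable l 0 P -> definable l N P.
  by case=> g [wg sg]; exists g; split=> // A a _; apply: sg.
have Dc i c : definable l N (fun n a => a i = c) by apply/weaken/D_eq_const.
have Dle i j : definable l N (fun n a => a i <= a j) by apply/weaken/D_leq.
have DN : definable l N (fun n a => n = N).
  suff H : definable l N (fun n a => exists m, m <= n /\ (m = N /\ forall v, v <= n -> v <= m)).
    apply: (D_ext _ H) => n a Nn _; split=> [[m [mn [Em H']]]|->]; last by exists N.
    by have := H' n (leqnn n); lia.
  by definability.
have Dtab : definable l N (fun n a => exists p, p < N.+1 /\ (exists q, q < N.+1 /\
    (R N p q /\ (a 0 = p /\ a 1 = q)))).
  apply: D_bounded_or => p; apply: D_bounded_or => q.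
  by apply: D_and; first exact: D_prop; definability.
have Dbig : definable l N (fun n a => ~ n = N /\ R n (a 0) (a 1)).
  case: DN => g [wg sg]; exists (FAnd (FNot g) f).
  split=> [s|A a nA an] /=; first by rewrite wg wff.
  have := sg A a nA an; case: (eqVneq (st_n A) N) => [->|nN]; first by tauto.
  have := sf A a; rewrite ltn_neqAle eq_sym nN nA => /(_ isT an); tauto.
apply: (D_ext _ (D_or Dbig (D_and DN Dtab))) => n a Nn an.
split=> [[[] //|[-> [p [_ [q [_ [Rpq [-> ->]]]]]]] //]|Ra].
case: (eqVneq n N) => [En|/eqP nN]; last by left.
right; split=> //; exists (a 0); split; first by rewrite -En ltnS.
by exists (a 1); rewrite -En ltnS.
Qed.

(** * The order by rows and the predicates C and Q in FO(Bit) *)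

Section Triangular.
Variable N : nat.
Hypothesis N_large : forall n, N <= n -> 256 <= trunc_log 2 n.

(** The even one of [a i] and its successor is halved before multiplying, since [tri (a i)] may be
    an element when its double is not. *)
Lemma DB_tri i j : DB N (fun n a => tri (a i) = a j).
Proof.
have Dmul i' j' k' := DB_muln N_large i' j' k'.
suff H : DB N (fun n a => exists s, s <= n /\ ((a i).+1 = s /\ exists h, h <= n /\
    (h + h = a i /\ h * s = a j \/ h + h = s /\ a i * h = a j))).
  apply: (D_ext _ H) => n a Nn an; have T := tri_double (a i).
  split=> [[_ [_ [<- [h [_ Hh]]]]]|Et]; first by nia.
  have n2 : 1 < n by have := large_leq N_large Nn; have := N_large Nn; lia.
  exists (a i).+1; split; first by have := an i; have := an j; nia.
  split=> //; case: (boolP (odd (a i))) => o.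
    exists (a i).+1./2; split; first by have := an i; lia.
    have Eh : (a i).+1./2 + (a i).+1./2 = (a i).+1.
      by rewrite addnn -[RHS]odd_double_half oddS o.
    move: Eh; set h := _./2 => Eh.
    by right; split=> //; move: T; rewrite -Eh mulnDr Et; lia.
  exists (a i)./2; split; first by have := an i; lia.
  have Eh : (a i)./2 + (a i)./2 = a i.
    by rewrite addnn -[RHS]odd_double_half (negbTE o).
  move: Eh; set h := _./2 => Eh.
  by left; split=> //; move: T; rewrite Et -[in RHS]Eh mulnDl Eh; lia.
by definability.
Qed.
#[local] Hint Resolve DB_tri : definability.

Definition coords (x c r : nat) : Prop := c = col x /\ r = row x.

Lemma DB_coords i j k : DB N (fun n a => coords (a i) (a j) (a k)).
Proof.
suff H : DB N (fun n a => exists z, z <= n /\ (tri (a j) = z /\ (z + a k = a i /\ a k <= a j))).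
  apply: (D_ext _ H) => n a _ an; rewrite /coords col_rowP.
  split=> [[_ [_ [<-]]] //|[E rc]]; exists (tri (a j)); split=> //.
  by have := an i; lia.
by definability.
Qed.
#[local] Hint Resolve DB_coords : definability.

Lemma coords_leq n x : x <= n -> col x <= n /\ row x <= n.
Proof. by have := col_row x; have := tri_geq (col x); lia. Qed.

Lemma DB_lhd : DB N (fun n a => lhd (a 0) (a 1)).
Proof.
suff H : DB N (fun n a => exists c, c <= n /\ exists r, r <= n /\ (coords (a 0) c r /\
    exists c', c' <= n /\ exists r', r' <= n /\ (coords (a 1) c' r' /\
    (r < r' \/ r = r' /\ c < c')))).
  apply: (D_ext _ H) => n a _ an; rewrite /lhd.
  have [c0 r0] := coords_leq (an 0); have [c1 r1] := coords_leq (an 1).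
  split=> [[_ [_ [_ [_ [[-> ->] [_ [_ [_ [_ [[-> ->] h]]]]]]]]]]|h]; first by lia.
  exists (col (a 0)); split=> //; exists (row (a 0)); split=> //; split=> //.
  exists (col (a 1)); split=> //; exists (row (a 1)); split=> //; split=> //; lia.
by definability.
Qed.

Lemma DB_Cset : DB N (fun n a => Cset (a 0)).
Proof.
suff H : DB N (fun n a => exists c, c <= n /\ exists r, r <= n /\ (coords (a 0) c r /\
    exists c', c' <= n /\ (c.+1 = c' /\ bit c' r))).
  apply: (D_ext _ H) => n a Nn an; have [c0 r0] := coords_leq (an 0).
  split=> [[_ [_ [_ [_ [[-> ->] [_ [_ [<-]]]]]]]] //|h].
  exists (col (a 0)); split=> //; exists (row (a 0)); split=> //; split=> //.
  exists (col (a 0)).+1; split=> //.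
  have n2 : 2 < n by have := large_leq N_large Nn; have := N_large Nn; lia.
  by have := col_row (a 0); have := an 0; have := tri_double (col (a 0)); nia.
by definability.
Qed.

(** In the last column [tri c.+1] lies outside the universe, so it is split as [tri c + c.+1], and
    only a bit of this sum is used. *)
Lemma DB_Qset : DB N (fun n a => Qset (a 0)).
Proof.
suff H : DB N (fun n a => exists c, c <= n /\ exists r, r <= n /\ (coords (a 0) c r /\
    exists c', c' <= n /\ (c.+1 = c' /\ exists z, z <= n /\ (tri c = z /\ bit (z + c') r)))).
  apply: (D_ext _ H) => n a Nn an; have [c0 r0] := coords_leq (an 0).
  rewrite /Qset triS.
  split=> [[_ [_ [_ [_ [[-> ->] [_ [_ [<- [_ [_ [<-]]]]]]]]]]] //|h].
  exists (col (a 0)); split=> //; exists (row (a 0)); split=> //; split=> //.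
  have n2 : 2 < n by have := large_leq N_large Nn; have := N_large Nn; lia.
  have := col_row (a 0); have := an 0; have := tri_double (col (a 0)) => h1 h2 h3.
  exists (col (a 0)).+1; split; first by nia.
  by split=> //; exists (tri (col (a 0))); split; first lia.
by definability.
Qed.
End Triangular.

Lemma Bit_defines_columns :
  translates [:: Lt_b; Lhd_b; C_b; Q_b] [:: Bit_b].
Proof.
(* From [2 ^ 256] on the encodings fit; smaller sizes are left to [D_all_sizes]. *)
have [N N_large] : exists N, forall n, N <= n -> 256 <= trunc_log 2 n.
  by exists (2 ^ 256) => n; apply: trunc_log_max.
have Dlt := DB_lt 0.
apply: translates_of_definable => -[|[|[|[|j]]]] //= _.
- by apply: (@D_all_sizes _ N (fun _ x y => lhd x y)) => //; apply: DB_lhd.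
- by apply: (@D_all_sizes _ N (fun _ x _ => Cset x)) => //; apply: DB_Cset.
- by apply: (@D_all_sizes _ N (fun _ x _ => Qset x)) => //; apply: DB_Qset.
Qed.

(** * Bit from columns and rows *)

Local Notation DC := (definable [:: Lt_b; Lhd_b; C_b; Q_b]).

Lemma DC_lt N i j : DC N (fun n a => a i < a j).
Proof.
apply: (D_inst2 (R := fun _ x y => x < y)).
by apply: (@D_binary _ _ 0 (fun x y => x < y)).
Qed.

Lemma DC_lhd N i j : DC N (fun n a => lhd (a i) (a j)).
Proof. by apply: (D_inst2 (R := fun _ x y => lhd x y)); apply: (@D_binary _ _ 1). Qed.

Lemma DC_Cset N i : DC N (fun n a => Cset (a i)).
Proof. by apply: (D_inst1 (R := fun _ x => Cset x)); apply: (@D_unary _ _ 2). Qed.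

Lemma DC_Qset N i : DC N (fun n a => Qset (a i)).
Proof. by apply: (D_inst1 (R := fun _ x => Qset x)); apply: (@D_unary _ _ 3). Qed.

Lemma DC_leq N i j : DC N (fun n a => a i <= a j).
Proof. by apply: D_leq => *; apply: DC_lt. Qed.

Lemma DC_succ N i j : DC N (fun n a => (a i).+1 = a j).
Proof. by apply: D_succ => *; apply: DC_lt. Qed.

Lemma DC_eq_const N i c : DC N (fun n a => a i = c).
Proof. by apply: D_eq_const => *; apply: DC_lt. Qed.

#[local] Hint Resolve DC_lt DC_lhd DC_Cset DC_Qset DC_leq DC_succ DC_eq_const : definability.

(** Elements up to column [m] thus have all their bits at positions below [m]. The induction starts
    from [tri 5 = 15 < 2 ^ 4]; at [m = 3] the inequality fails, as [tri 4 = 10]. *)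
Lemma triS_lt_exp m : 4 <= m -> tri m.+1 < 2 ^ m.
Proof.
move=> m4; rewrite -(subnK m4); elim: (m - 4) => // k IH.
by rewrite addSn triS expnS; have := tri_double (k + 4).+1; nia.
Qed.

(** Every column before that of [n] lies completely in the universe. *)
Lemma row_exists c r n : r <= c -> c < col n -> exists x, x <= n /\ col x = c /\ row x = r.
Proof.
move=> rc cn; exists (tri c + r); rewrite col_tri // row_tri //; split=> //.
by have := tri_mono cn; have := col_row n; rewrite triS; lia.
Qed.

Section Columns.
(* From size 10 on, every bit position of an element is the row of some element. *)
Let N := 10.

Lemma bit_row n x j : N <= n -> x <= n -> bit x j -> exists y, y <= n /\ row y = j.
Proof.
(* [tri 4 = 10], so [n] lies in column 4 or later. *)
move=> Nn xn; have m4 : 4 <= col n.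
  case: (leqP 4 (col n)) => // n4; have /andP[_] := col_bounds n.
  by have := tri_mono n4; rewrite (_ : tri 4 = 10) //; rewrite /N in Nn; lia.
move=> /(bit_lt_exp (m := col n)) jm.
have {}jm : j < col n.
  by apply: jm; have := triS_lt_exp m4; have /andP[_] := col_bounds n; lia.
have [y [yn [_ ry]]] := @row_exists (col n).-1 j n ltac:(lia) ltac:(lia).
by exists y.
Qed.

(** The element 2 is the [lhd]-least one of row 1, so exactly row 0 precedes it. *)
Lemma DC_row0 i : DC N (fun n a => row (a i) = 0).
Proof.
suff H : DC N (fun n a => exists y, y <= n /\ (y = 2 /\ lhd (a i) y)).
  have r2 : row 2 = 1 by apply: (@row_tri 1 1).
  have c2 : col 2 = 1 by apply: (@col_tri 1 1).
  apply: (D_ext _ H) => n a Nn an; rewrite /lhd.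
  split=> [[_ [_ [->]]]|r0]; last first.
    by exists 2; rewrite r2 r0; rewrite /N in Nn; split=> //; lia.
  by rewrite r2 c2; have := row_leq_col (a i); lia.
by definability.
Qed.
#[local] Hint Resolve DC_row0 : definability.

(** Elements of row 0 begin the columns, so one of them separates elements of different columns. *)
Lemma DC_col_lt i j : DC N (fun n a => col (a i) < col (a j)).
Proof.
suff H : DC N (fun n a => exists z, z <= n /\ (row z = 0 /\ a i < z /\ z <= a j)).
  apply: (D_ext _ H) => n a Nn an; split=> [[z [zn [z0 [xz zy]]]]|xy].
    rewrite ltnNge; apply/negP => yx; have /andP[_ hy] := col_bounds (a j).
    have hx := col_row (a i); have hz := col_row z.
    case: (ltnP (col z) (col (a j)).+1) => [zj|/tri_mono]; last by lia.
    have zj' : col z <= col (a i) by lia.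
    by have := tri_mono zj'; lia.
  exists (tri (col (a j))); have := col_row (a j); have := an j => h1 h2.
  split; first lia; split; first by rewrite -(addn0 (tri _)) row_tri.
  by have := tri_mono xy; have /andP[_] := col_bounds (a i); lia.
by definability.
Qed.
#[local] Hint Resolve DC_col_lt : definability.

(** Unless [a i] is in an earlier column, [lhd] compares rows strictly. Otherwise it compares them
    weakly, and [a j] is replaced by its predecessor, which lies in the same column with row smaller
    by one. *)
Lemma DC_row_lt i j : DC N (fun n a => row (a i) < row (a j)).
Proof.
suff H : DC N (fun n a => ~ col (a i) < col (a j) /\ lhd (a i) (a j) \/
    col (a i) < col (a j) /\ ~ row (a j) = 0 /\
    exists z, z <= n /\ (z.+1 = a j /\ lhd (a i) z)).
  apply: (D_ext _ H) => n a Nn an; case: (ltnP (col (a i)) (col (a j))) => cij; last first.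
    by rewrite /lhd; lia.
  have pred z : z.+1 = a j -> ~ row (a j) = 0 ->
      col z = col (a j) /\ (row z).+1 = row (a j).
    move=> Ez rj; have rc := row_leq_col (a j).
    have -> : z = tri (col (a j)) + (row (a j)).-1 by have := col_row (a j); lia.
    by rewrite col_tri ?row_tri; lia.
  split=> [[[] //|[_ [rj [z [_ [Ez]]]]]]|rij].
    by have [] := pred z Ez rj; rewrite /lhd; lia.
  right; split=> //; split; first lia.
  have Ez : (a j).-1.+1 = a j by have := col_row (a j); lia.
  exists (a j).-1; split; first by have := an j; lia.
  by split=> //; have [|] := pred _ Ez; rewrite /lhd; lia.
by definability.
Qed.
#[local] Hint Resolve DC_row_lt : definability.

Lemma DC_row_eq i j : DC N (fun n a => row (a i) = row (a j)).
Proof.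
suff H : DC N (fun n a => ~ row (a i) < row (a j) /\ ~ row (a j) < row (a i)).
  by apply: (D_ext _ H) => n a _ _; lia.
by definability.
Qed.
#[local] Hint Resolve DC_row_eq : definability.

Lemma DC_col_succ i j : DC N (fun n a => (col (a i)).+1 = col (a j)).
Proof.
suff H : DC N (fun n a => col (a i) < col (a j) /\
    ~ exists z, z <= n /\ (col (a i) < col z /\ col z < col (a j))).
  apply: (D_ext _ H) => n a _ an.
  split=> [[cij nz]|<-]; last by split=> // -[z]; lia.
  apply/eqP; rewrite eqn_leq cij leqNgt /=; apply/negP => lt_ij; apply: nz.
  have [z [zn [cz _]]] := row_exists (leq0n _) lt_ij.
  by exists z; rewrite cz; have := an j; split=> //; lia.
by definability.
Qed.
#[local] Hint Resolve DC_col_succ : definability.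

(** The least element of row [r] is the end of column [r]; it converts a row index into a column
    index. *)
Lemma DC_col_succ_row i j : DC N (fun n a => (col (a i)).+1 = row (a j)).
Proof.
suff H : DC N (fun n a => exists d, d <= n /\ (row d = row (a j) /\
    (forall e, e <= n -> row e = row (a j) -> ~ e < d) /\ (col (a i)).+1 = col d)).
  apply: (D_ext _ H) => n a _ an.
  have dn : tri (row (a j)) + row (a j) <= n.
    by have := an j; have := col_row (a j); have := tri_mono (row_leq_col (a j)); lia.
  move: (row (a j)) dn => r dn.
  have min e : row e = r -> tri r + r <= e.
    by move=> er; have := col_row e; have := tri_mono (row_leq_col e); rewrite er; lia.
  split=> [[d [_ [rd [dmin ->]]]]|Ei].
    have : ~ tri r + r < d by apply: dmin => //; rewrite row_tri.
    have := min d rd => h1 h2; have -> : d = tri r + r by lia.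
    by rewrite col_tri.
  exists (tri r + r); rewrite row_tri // col_tri //; split=> //; split=> //; split=> //.
  by move=> e _ /min; lia.
by definability.
Qed.
#[local] Hint Resolve DC_col_succ_row : definability.

(** [Qset] in column [c - 1] lists the bits of [tri c], and the rows of that column cover all of
    them because [tri c < 2 ^ c]. *)
Lemma DC_bit_tri i j : DC N (fun n a => bit (tri (col (a i))) (row (a j))).
Proof.
suff H : DC N (fun n a => exists y, y <= n /\ (row y = row (a j) /\
    (col y).+1 = col (a i) /\ Qset y)).
  apply: (D_ext _ H) => n a _ an; split=> [[y [_ [ry [cy]]]]|bij].
    by rewrite /Qset cy ry.
  have jc : row (a j) < col (a i) by apply: bit_lt_exp bij; apply: tri_lt_exp.
  have [y [yn [cy ry]]] := @row_exists (col (a i)).-1 (row (a j)) (a i) ltac:(lia) ltac:(lia).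
  exists y; split; first exact: leq_trans yn (an i).
  have cy' : (col y).+1 = col (a i) by lia.
  by rewrite /Qset cy' ry.
by definability.
Qed.
#[local] Hint Resolve DC_bit_tri : definability.

(** [Cset] in column [r - 1] lists the bits of [r], all of which are at positions below [r]. *)
Lemma DC_bit_row i j : DC N (fun n a => bit (row (a i)) (row (a j))).
Proof.
suff H : DC N (fun n a => exists y, y <= n /\ (row y = row (a j) /\
    (col y).+1 = row (a i) /\ Cset y)).
  apply: (D_ext _ H) => n a _ an; split=> [[y [_ [ry [cy]]]]|bij].
    by rewrite /Cset cy ry.
  have jc := bit_lt bij; have rc := row_leq_col (a i).
  have [y [yn [cy ry]]] := @row_exists (row (a i)).-1 (row (a j)) (a i) ltac:(lia) ltac:(lia).
  exists y; split; first exact: leq_trans yn (an i).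
  have cy' : (col y).+1 = row (a i) by lia.
  by rewrite /Cset cy' ry.
by definability.
Qed.
#[local] Hint Resolve DC_bit_row : definability.

(** Carry lookahead for the sum of [tri (col (a i))] and [row (a i)], with positions named by the
    rows of elements. Every position below [row (a j)] is a row in the column of [a j]. *)
Lemma DC_bit_at_row i j : DC N (fun n a => bit (a i) (row (a j))).
Proof.
suff H : DC N (fun n a =>
    (bit (tri (col (a i))) (row (a j)) (+) bit (row (a i)) (row (a j))) <->
    ~ exists p, p <= n /\ (row p < row (a j) /\
        (bit (tri (col (a i))) (row p) && bit (row (a i)) (row p)) /\
        forall q, q <= n -> row p < row q -> row q < row (a j) ->
          bit (tri (col (a i))) (row q) || bit (row (a i)) (row q))).
  apply: (D_ext _ H) => n a _ an.
  have -> : bit (a i) (row (a j)) = bit (tri (col (a i)) + row (a i)) (row (a j)).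
    by rewrite col_row.
  rewrite bit_addP carryP.
  set x := tri _; set y := row (a i); set k := row (a j).
  have ex p : p < k -> exists z, z <= n /\ row z = p.
    move=> pk; exists (tri (col (a j)) + p); have := col_row (a j); have := an j => h1 h2.
    by have := row_leq_col (a j) => h3; rewrite row_tri; lia.
  suff E : (exists2 p, p < k & bit x p && bit y p /\
        forall q, p < q -> q < k -> bit x q || bit y q) <->
      exists p, p <= n /\ (row p < k /\ (bit x (row p) && bit y (row p)) /\
        forall q, q <= n -> row p < row q -> row q < k -> bit x (row q) || bit y (row q)).
    by rewrite E.
  split=> [[p pk [b1 H1]]|[p [pn [pk [b1 H1]]]]].
    have [z [zn zp]] := ex p pk.
    by exists z; rewrite zp; split=> //; split=> //; split=> // q _; apply: H1.
  exists (row p) => //; split=> // q pq qk; have [z [zn zq]] := ex q qk.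
  by rewrite -zq; apply: H1; rewrite ?zq.
by definability.
Qed.
#[local] Hint Resolve DC_bit_at_row : definability.

(** By [bit_row] all bits of both sides are at positions that are rows, so agreement there is
    equality. This identifies a position given as a row with the element of that value. *)
Lemma DC_eq_row i j : DC N (fun n a => a i = row (a j)).
Proof.
suff H : DC N (fun n a => forall r, r <= n -> (bit (a i) (row r) <-> bit (row (a j)) (row r))).
  apply: (D_ext _ H) => n a Nn an; split=> [H'|-> //].
  have rj : row (a j) <= n by have := col_row (a j); have := an j; lia.
  have sub x y : x <= n -> (forall r, r <= n -> bit x (row r) -> bit y (row r)) ->
      forall k, bit x k -> bit y k.
    move=> xn xy k bk; have [r [rn rk]] := bit_row Nn xn bk.
    by rewrite -rk; apply: xy => //; rewrite rk.
  apply: bit_ext => k; apply/Bool.eq_iff_eq_true; split; apply: sub => // r rn.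
    by case: (H' r rn).
  by case: (H' r rn).
by definability.
Qed.
#[local] Hint Resolve DC_eq_row : definability.

Lemma DC_bit i j : DC N (fun n a => bit (a i) (a j)).
Proof.
suff H : DC N (fun n a => exists r, r <= n /\ (a j = row r /\ bit (a i) (row r))).
  apply: (D_ext _ H) => n a Nn an; split=> [[r [_ [->]]] //|bij].
  by have [r [rn rj]] := bit_row Nn (an i) bij; exists r; rewrite rj.
by definability.
Qed.
End Columns.

Lemma columns_define_Bit : translates [:: Bit_b] [:: Lt_b; Lhd_b; C_b; Q_b].
Proof.
apply: translates_of_definable => -[|j] //= _.
apply: (@D_all_sizes _ 10 (fun _ x y => bit x y)); last exact: DC_bit.
exact: DC_lt.
Qed.

Theorem theorem3p1 :
  same_expressive_power [:: Lt_b; Lhd_b; C_b; Q_b] [:: Bit_b].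
Proof. by split; [apply: Bit_defines_columns | apply: columns_define_Bit]. Qed.
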